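(* Under Assumptions 1, 2 and 3 (stated in the context), for every node $i\in[n]$, $$\lim_{t\to\infty}\mathbf{q}_i^{(t)}=\mathbf{1}_M\quad \mathsf{P}\text{-a.s.},$$ i.e. $q_i^{(t)}(\theta_M)\to 1$ and $q_i^{(t)}(\theta_k)\to 0$ for all $k\in[M-1]$, almost surely. Moreover, the rate of rejection satisfies $$\boldsymbol{\rho}_i=-\lim_{t\to\infty}\frac{1}{t}\log \tilde{\mathbf{q}}_i^{(t)}=\mathbf{K}\quad \mathsf{P}\text{-a.s.},$$ where $\tilde{\mathbf{q}}_i^{(t)}=[q_i^{(t)}(\theta_1),\dots,q_i^{(t)}(\theta_{M-1})]^T$, the logarithm is taken componentwise, and $\mathbf{K}=[K(\theta_M,\theta_1),\dots,K(\theta_M,\theta_{M-1})]^T$. In particular, for every $k\in[M-1]$, $-\frac1t\log q_i^{(t)}(\theta_k)\to K(\theta_M,\theta_k)$ almost surely.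
   Context: There are $n$ nodes and a finite set of hypotheses $\Theta=\{\theta_1,\dots,\theta_M\}$. Node $i$ has an observation space $\mathcal{X}_i$; $\mathcal{X}=\mathcal{X}_1\times\cdots\times\mathcal{X}_n$. For each $k\in[M]$, $f(\cdot;\theta_k)$ is a joint probability distribution (density or mass function) on $\mathcal{X}$ whose $i$-th marginal is $f_i(\cdot;\theta_k)$. The true hypothesis is $\theta_M$: the observation profiles $X^{(t)}=(X_1^{(t)},\dots,X_n^{(t)})$, $t=1,2,\dots$, are i.i.d. over $t$ with law $f(\cdot;\theta_M)$ (the components of $X^{(t)}$ may be dependent). $\mathsf{P}$ denotes the induced probability measure on observation sequences and $D(\cdot\|\cdot)$ the Kullback–Leibler divergence. $W$ is an $n\times n$ row-stochastic matrix with nonnegative entries such that for $j\neq i$, $W_{ij}>0$ iff there is a directed edge from $j$ to $i$ in the communication graph on $[n]$. Learning rule: each node $i$ starts with a private belief $\mathbf{q}_i^{(0)}$, a probability vector on $\Theta$. For $t\ge1$ and each $k\in[M]$: (Bayesian update) $b_i^{(t)}(\theta_k)=\frac{f_i(X_i^{(t)};\theta_k)\,q_i^{(t-1)}(\theta_k)}{\sum_{a\in[M]}f_i(X_i^{(t)};\theta_a)\,q_i^{(t-1)}(\theta_a)}$; nodes send $\mathbf b_i^{(t)}$ to their out-neighbors; (log-linear consensus) $q_i^{(t)}(\theta_k)=\frac{\exp(\sum_{j=1}^n W_{ij}\log b_j^{(t)}(\theta_k))}{\sum_{a\in[M]}\exp(\sum_{j=1}^n W_{ij}\log b_j^{(t)}(\theta_a))}$.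 $\mathbf 1_M$ is the probability vector on $\Theta$ putting mass one on $\theta_M$. Assumption 1: for every pair $k\neq j$ in $[M]$ there is a node $i$ with $D(f_i(\cdot;\theta_k)\|f_i(\cdot;\theta_j))>0$. Assumption 2: the communication graph is strongly connected (so $W$ is irreducible). Assumption 3: $q_i^{(0)}(\theta_k)>0$ for all $i\in[n]$, $k\in[M]$. Let $\mathbf v=(v_1,\dots,v_n)$ be the stationary distribution of $W$, i.e. the probability vector with $v_i=\sum_j v_jW_{ji}$ (all $v_i>0$). The network divergence is $K(\theta_M,\theta_k)=\sum_{i=1}^n v_i\,D(f_i(\cdot;\theta_M)\|f_i(\cdot;\theta_k))$. *)

(* Defs.v *)
From HB Require Import structures.
From mathcomp Require Import all_boot all_order all_algebra.
From mathcomp Require Import all_classical all_reals all_analysis.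
Set Implicit Arguments. Unset Strict Implicit. Unset Printing Implicit Defensive.
Import Order.TTheory GRing.Theory Num.Theory.
Local Open Scope classical_set_scope.
Local Open Scope ring_scope.

Section DistributedLearning.
Local Unset Implicit Arguments.
Context {R : realType}.

Definition kl_integrand (a b : R) : \bar R :=
  if a == 0 then 0%E else if b == 0 then +oo%E else (a * ln (a / b))%:E.

Definition KL {d} {T : measurableType d} (mu : {measure set T -> \bar R})
  (p q : T -> R) : \bar R :=
  (\int[mu]_x kl_integrand (p x) (q x))%E.

Definition comm_edge {n} (W : 'M[R]_n) : rel 'I_n :=
  [rel j i | (j != i) && (0 < W i j)].

Definition strongly_connected {n} (W : 'M[R]_n) : Prop :=
  forall i j : 'I_n, connect (comm_edge W) i j.

Context {n m : nat}.
(* hypotheses theta_1 .. theta_M are indexed by 'I_m.+1 (M = m+1);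
   the true hypothesis theta_M is ord_max *)

(* Bayesian update at one node: L k = f_i(x_i; theta_k). *)
Definition bayes_update (L q : 'I_m.+1 -> R) : 'I_m.+1 -> R :=
  fun k => L k * q k / \sum_(a < m.+1) L a * q a.

(* Log-linear consensus:
   q_i(k) = exp(sum_j W_ij log b_j(k)) / sum_a exp(sum_j W_ij log b_j(a)),
   computed in the extended reals (log 0 = -oo, exp(-oo) = 0, 0 * -oo = 0). *)
Definition consensus_exponent (W : 'M[R]_n) (b : 'I_n -> 'I_m.+1 -> R)
  (i : 'I_n) (k : 'I_m.+1) : \bar R :=
  (\sum_(j < n) (W i j)%:E * lne (b j k)%:E)%E.

Definition consensus (W : 'M[R]_n) (b : 'I_n -> 'I_m.+1 -> R) :
  'I_n -> 'I_m.+1 -> R :=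
  fun i k => fine (expeR (consensus_exponent W b i k)) /
             \sum_(a < m.+1) fine (expeR (consensus_exponent W b i a)).

(* Beliefs q^{(t)} along a realization x of the observation profiles:
   x t is the profile X^{(t+1)} observed at time t+1. *)
Context {T : 'I_n -> Type} (f : forall i : 'I_n, 'I_m.+1 -> T i -> R)
  (W : 'M[R]_n) (q0 : 'I_n -> 'I_m.+1 -> R).

Fixpoint belief (x : nat -> forall i : 'I_n, T i) (t : nat) :
  'I_n -> 'I_m.+1 -> R :=
  match t with
  | 0 => q0
  | t'.+1 => consensus W
      (fun i => bayes_update (fun k => f i k (x t' i)) (belief x t' i))
  end.

End DistributedLearning.

(* sigma-algebra on Omega generated by the observation profile X t
   = (X t i)_i (the profile at time t+1). *)
Definition profile_events d (Omega : measurableType d) n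
  (dT : 'I_n -> measure_display) (T : forall i, measurableType (dT i))
  (X : nat -> forall i : 'I_n, Omega -> T i) (t : nat) : set_system Omega :=
  <<s [set E | exists i : 'I_n, exists A : set (T i),
                 measurable A /\ E = X t i @^-1` A] >>.

(* Main.v *)
Require Import Defs.
From HB Require Import structures.
From mathcomp Require Import all_boot all_order all_algebra.
From mathcomp Require Import all_classical all_reals all_analysis.
From mathcomp Require Import measurable_realfun.
From mathcomp Require Import ring lra zify.
Import Order.TTheory GRing.Theory Num.Theory.
Import numFieldNormedType.Exports.
Local Open Scope classical_set_scope.
Local Open Scope ring_scope.

(** Put r_i^t = q_i^t(k) / q_i^t(M) and let rho_j^t = f_j(X_j^t; k) / f_j(X_j^t; M).
    The normalisations cancel and log r^(t+1) = W (log rho^t + log r^t), a linear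
    recursion driven by i.i.d. noise.  When every D(f_j(M) || f_j(k)) is finite, log rho
    is integrable with mean minus that divergence, and the claim is that
    (log r_i^t) / t tends to the v-average of these means.

    As W may be periodic, its powers need not converge.  Still, some power W^N has
    an idempotent support, which is then an equivalence relation on which W^N acts
    as a Doeblin contraction, so the differences W^(s+N) - W^s are summable.
    Summation by parts along progressions of step N thus reduces the noise
    to averages over progressions, i.e. to the strong law of large numbers; the mean
    is handled by the Poisson equation x = g - W g.

    When some divergence is infinite, clip rho from below at exp(-B): this bounds r
    from above, and the clipped means tend to minus infinity with B. *)

(** * Irreducible stochastic matrices *)

(** Of the noise only the almost sure convergence of averages is known, and its terms are unbounded.
    Centred partial sums are therefore treated as [o(t)], and a kernel whose differences have
    bounded total mass keeps the convolution with the noise at [o(t)]. The differences have step [N]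
    because for a periodic [W] those of step 1 need not tend to 0. A progression of i.i.d. variables
    is again i.i.d., so the law of large numbers applies along it, one node at a time. The positive
    part of [log rho] has expectation at most 1, because [p * max(ln(r/p), 0) <= r] for densities
    [p] and [r]. Only small likelihood ratios can spoil integrability, and exactly there a clip from
    below helps: it costs the lower bound on [log r], which a limit [+oo] of the rate does not
    require. *)

Definition stochastic {R : realType} {n} (W : 'M[R]_n) : Prop :=
  (forall i j, 0 <= W i j) /\ (forall i, \sum_(j < n) W i j = 1).

Section Stochastic.
Context {R : realType} {n : nat}.
Implicit Types (W U : 'M[R]_n.+1) (x : 'cV[R]_n.+1) (v : 'rV[R]_n.+1).

Lemma stochastic1 : stochastic (1 : 'M[R]_n.+1).
Proof.
split=> [i j|i]; first by rewrite mxE; case: eqP.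
under eq_bigr => j _ do rewrite mxE.
rewrite (bigD1 i)//= eqxx big1 ?addr0// => j /negbTE.
by rewrite eq_sym => ->.
Qed.

Lemma stochasticM W U : stochastic W -> stochastic U -> stochastic (W * U).
Proof.
move=> [W0 W1] [U0 U1]; split=> [i j|i].
  by rewrite mxE sumr_ge0// => k _; rewrite mulr_ge0.
under eq_bigr => j _ do rewrite mxE.
rewrite exchange_big/= -[RHS](W1 i); apply: eq_bigr => k _.
by rewrite -mulr_sumr U1 mulr1.
Qed.

Lemma stochasticX W k : stochastic W -> stochastic (W ^+ k).
Proof.
move=> sW; elim: k => [|k IH]; first exact: stochastic1.
by rewrite exprS; apply: stochasticM.
Qed.

Lemma stochastic_contract W x b : stochastic W ->
  (forall i, `|x i 0| <= b) -> forall i, `|(W *m x) i 0| <= b.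
Proof.
move=> [W0 W1] xb i; rewrite mxE (le_trans (ler_norm_sum _ _ _))//.
rewrite -[leRHS]mul1r -(W1 i) mulr_suml ler_sum// => j _.
by rewrite normrM ger0_norm// ler_wpM2l.
Qed.

(** If [v a = 0], the nonnegative terms [v b * W b a] of [(v W) a] all vanish, so zeros spread along
    the edges of the communication graph. *)
Lemma invariant_eq0 W v : (forall i j, 0 <= W i j) -> strongly_connected W ->
  v *m W = v -> (forall j, 0 <= v 0 j) ->
  forall i, v 0 i = 0 -> v = 0.
Proof.
move=> W0 sc vW v0 i vi; apply/rowP => j; rewrite [RHS]mxE.
have step a b : v 0 a = 0 -> 0 < W b a -> v 0 b = 0.
  move=> + Wba; rewrite -{1}vW mxE => /eqP.
  rewrite psumr_eq0 => [/allP/(_ b (mem_index_enum _))/=|c _]; last first.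
    by rewrite mulr_ge0.
  by rewrite mulf_eq0 (gt_eqF Wba) orbF => /eqP.
have /connectP[p] := sc i j.
elim: p i vi => [|a p IH] i vi /=; first by move=> _ ->.
by move=> /andP[/andP[_ Wai] pp] jl; apply: IH jl => //; exact: step Wai.
Qed.

Lemma invariant_gt0 W v : (forall i j, 0 <= W i j) -> strongly_connected W ->
  v *m W = v -> (forall j, 0 <= v 0 j) -> v != 0 -> forall i, 0 < v 0 i.
Proof.
move=> W0 sc vW v0 vn0 i; rewrite lt0r v0 andbT.
by apply: contra vn0 => /eqP vi; apply/eqP; exact: invariant_eq0 vi.
Qed.

(** Subtracting from [c] the multiple of [v] given by the smallest ratio [c i / v i] leaves a
    nonnegative invariant vector with a zero entry. *)
Lemma invariant_unique W v c : (forall i j, 0 <= W i j) ->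
  strongly_connected W -> v *m W = v -> (forall j, 0 < v 0 j) ->
  c *m W = c -> exists l, c = l *: v.
Proof.
move=> W0 sc vW v0 cW.
have [i _ imin] := @arg_minP _ _ _ ord0 predT (fun i => c 0 i / v 0 i) isT.
exists (c 0 i / v 0 i); apply/eqP; rewrite -subr_eq0; apply/eqP.
apply: (@invariant_eq0 W _ W0 sc _ _ i).
- by rewrite mulmxBl cW -scalemxAl vW.
- by move=> j; rewrite !mxE subr_ge0 -ler_pdivlMr// imin.
- by rewrite !mxE divfK ?subrr// gt_eqF.
Qed.

(* Fredholm alternative: the left kernel of [1 - W] is spanned by [v]. *)
Lemma poisson_equation W v x : (forall i j, 0 <= W i j) ->
  strongly_connected W -> v *m W = v -> (forall j, 0 < v 0 j) ->
  v *m x = 0 -> exists g : 'cV_n.+1, x = g - W *m g.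
Proof.
move=> W0 sc vW v0 vx.
(* The inclusion below concerns row spaces, hence the transposes. The columns of [cokermx B],
   transposed, are invariant under [W], hence multiples of [v], and [v] annihilates [x]. *)
set B := (1%:M - W)^T.
suff /submxP[D xD] : (x^T <= B)%MS.
  exists D^T; rewrite -[LHS]trmxK xD trmx_mul /B trmxK.
  by rewrite mulmxBl mul1mx.
rewrite submxE; apply/eqP/matrixP => i j; rewrite (ord1 i) [RHS]mxE.
have : (col j (cokermx B))^T *m W = (col j (cokermx B))^T.
  apply/eqP; rewrite eq_sym -subr_eq0 -{1}[(col _ _)^T]mulmx1 -mulmxBr.
  rewrite -[_ - W]trmxK -/B -trmx_mul colE mulmxA mulmx_coker mul0mx.
  by rewrite trmx0.
move=> /(invariant_unique _ _ _ W0 sc vW v0)[l cl].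
have -> : (x^T *m cokermx B) 0 j = ((col j (cokermx B))^T *m x) 0 0.
  by rewrite !mxE; apply: eq_bigr => k _; rewrite !mxE mulrC.
by rewrite cl -scalemxAl vx scaler0 mxE.
Qed.

End Stochastic.

(** * Supports of the powers of a stochastic matrix *)

Section Support.
Context {R : realType} {n : nat}.
Implicit Types (W U V : 'M[R]_n.+1).

Definition supp (M : 'M[R]_n.+1) : {set 'I_n.+1 * 'I_n.+1} :=
  [set p : 'I_n.+1 * 'I_n.+1 | 0 < M p.1 p.2]%SET.

Lemma mulmx_gt0 W U i j : (forall i j, 0 <= W i j) -> (forall i j, 0 <= U i j) ->
  (0 < (W * U) i j) = [exists k, (0 < W i k) && (0 < U k j)].
Proof.
move=> W0 U0; rewrite mxE; apply/idP/existsP => [|[k /andP[Wk Uk]]]; last first.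
  by rewrite (bigD1 k)//= ltr_pwDl ?mulr_gt0// sumr_ge0// => l _; rewrite mulr_ge0.
rewrite lt0r => /andP[+ _]; rewrite psumr_neq0; last first.
  by move=> k _; rewrite mulr_ge0.
move=> /hasP[k _ /=]; rewrite lt0r mulf_eq0 negb_or => /andP[/andP[Wk Uk] _].
by exists k; rewrite !lt0r Wk Uk W0 U0.
Qed.

Lemma supp_mulr W U V : (forall i j, 0 <= W i j) -> (forall i j, 0 <= U i j) ->
  (forall i j, 0 <= V i j) -> supp W = supp U -> supp (W * V) = supp (U * V).
Proof.
move=> W0 U0 V0 /setP WU; apply/setP => -[i j]; rewrite !inE !mulmx_gt0//=.
by apply: eq_existsb => k; have := WU (i, k); rewrite !inE/= => ->.
Qed.

(** There are finitely many supports, and the support of a product depends only on those of its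
    factors; so the supports of the powers are periodic from some [a] on, with period [b - a]. A
    positive multiple of the period that is at least [a] can be doubled without changing the
    support. *)
Lemma supp_idempotent_power W : stochastic W ->
  exists2 N, (0 < N)%N & supp (W ^+ (N + N)) = supp (W ^+ N).
Proof.
move=> sW.
have W0 k : forall i j, 0 <= (W ^+ k) i j by case: (stochasticX _ k sW).
pose F (k : 'I_#|{set 'I_n.+1 * 'I_n.+1}|.+1) := supp (W ^+ k).
have : ~~ injectiveb F.
  apply/negP => /injectiveP/leq_card; by rewrite card_ord ltnn.
move=> /injectivePn[a0 [b0 ab0 E0]].
have [a [b [ab E]]] : exists a b, (a < b)%N /\ supp (W ^+ a) = supp (W ^+ b).
  have := ab0; rewrite -val_eqE neq_ltn => /orP[?|?].
    by exists a0, b0.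
  by exists b0, a0.
have per1 t : (a <= t)%N -> supp (W ^+ (t + (b - a))) = supp (W ^+ t).
  move=> at_; have -> : (t + (b - a) = b + (t - a))%N by lia.
  have {2}-> : (t = a + (t - a))%N by lia.
  by rewrite !exprD; apply/esym/supp_mulr.
have per t l : (a <= t)%N -> supp (W ^+ (t + l * (b - a))) = supp (W ^+ t).
  move=> at_; elim: l => [|l IH]; first by rewrite mul0n addn0.
  by rewrite mulSn addnCA addnC per1 ?IH// (leq_trans at_)// leq_addr.
exists (a.+1 * (b - a))%N; first by rewrite muln_gt0/= subn_gt0.
by rewrite per// (leq_trans (leqnSn a))// leq_pmulr// subn_gt0.
Qed.

End Support.

(** * Contraction on the classes of an idempotent support *)

Section Contraction.
Context {R : realType} {n : nat}.
Implicit Types (W U V : 'M[R]_n.+1) (x : 'cV[R]_n.+1) (v : 'rV[R]_n.+1).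

Lemma supp_idempotent_trans U i j k : (forall i j, 0 <= U i j) ->
  supp (U * U) = supp U -> 0 < U i j -> 0 < U j k -> 0 < U i k.
Proof.
move=> U0 /setP/(_ (i, k)); rewrite !inE/= mulmx_gt0// => <- ij jk.
by apply/existsP; exists j; rewrite ij jk.
Qed.

(* The set of states reachable from [j] is closed, so it cannot gain mass from
   outside under the positive invariant vector [v]. *)
Lemma supp_idempotent_sym U v i j : stochastic U ->
  supp (U * U) = supp U -> v *m U = v -> (forall i, 0 < v 0 i) ->
  0 < U i j -> 0 < U j i.
Proof.
move=> [U0 U1] UU vU v0 ij.
have tr a b c := supp_idempotent_trans U a b c U0 UU.
pose A := [pred l | (l == j) || (0 < U j l)].
have Acl a b : A a -> ~~ A b -> U a b = 0.
  rewrite /= negb_or => /orP[/eqP->|ja] /andP[bj jb].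
    by apply/eqP; rewrite eq_le U0 andbT leNgt.
  apply/eqP; rewrite eq_le U0 andbT leNgt; apply/negP => ab.
  by rewrite (tr _ _ _ ja ab) in jb.
have Arow a : A a -> \sum_(l | A l) U a l = 1.
  move=> Aa; rewrite -(U1 a) [RHS](bigID A)/= [X in _ + X]big1 ?addr0// => b Ab.
  exact: Acl.
have AE : \sum_(l | A l) v 0 l = \sum_k v 0 k * \sum_(l | A l) U k l.
  under [RHS]eq_bigr => k _ do rewrite mulr_sumr.
  rewrite exchange_big/=; apply: eq_bigr => l _.
  by rewrite -{1}vU mxE.
have A0 : \sum_(k | ~~ A k) v 0 k * \sum_(l | A l) U k l = 0.
  move: AE; rewrite [RHS](bigID A)/= => /eqP.
  rewrite [X in _ == X + _](eq_bigr (v 0)); last first.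
    by move=> a /Arow; rewrite /A/= => ->; rewrite mulr1.
  by rewrite -subr_eq0 opprD addNKr oppr_eq0 => /eqP.
case: (boolP (A i)) => [/orP[/eqP ijE|//]|Ai]; first by move: ij; rewrite ijE.
move: A0 => /eqP; rewrite psumr_eq0 => [/allP/(_ i (mem_index_enum _))|k _].
  rewrite Ai/= mulf_eq0 (gt_eqF (v0 i))/= psumr_eq0// => /allP.
  by move=> /(_ j (mem_index_enum _)); rewrite eqxx/= (gt_eqF ij).
by rewrite mulr_ge0// ?(ltW (v0 _))// sumr_ge0.
Qed.

(** A row has a positive entry since it sums to 1; symmetry leads back and transitivity closes the
    loop. *)
Lemma supp_idempotent_refl U v i : stochastic U ->
  supp (U * U) = supp U -> v *m U = v -> (forall i, 0 < v 0 i) -> 0 < U i i.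
Proof.
move=> sU UU vU v0; have [U0 U1] := sU.
have [/existsP[j ij]|/existsPn H] := boolP [exists j, 0 < U i j].
  apply: (@supp_idempotent_trans U i j i) => //.
  exact: supp_idempotent_sym vU v0 ij.
have := U1 i; rewrite big1 => [/esym/eqP|j _]; first by rewrite oner_eq0.
by apply/eqP; rewrite eq_le U0 andbT leNgt H.
Qed.

Lemma positive_entries_bound U : stochastic U ->
  exists c : R, [/\ 0 < c, c <= 1 & forall i j, 0 < U i j -> c <= U i j].
Proof.
move=> [U0 U1].
pose p0 : 'I_n.+1 * 'I_n.+1 := (ord0, ord0).
pose g (p : 'I_n.+1 * 'I_n.+1) := if 0 < U p.1 p.2 then U p.1 p.2 else 1.
have [p _ pmin] := @arg_minP _ _ _ p0 predT g isT.
exists (g p); split.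
- by rewrite /g; case: ifP.
- rewrite /g; case: ifP => // _; rewrite -(U1 p.1) (bigD1 p.2)//= lerDl.
  exact: sumr_ge0.
- by move=> i j ij; apply: le_trans (pmin (i, j) isT) _; rewrite {1}/g/= ij.
Qed.

(** When the support of [U] is an equivalence relation, the [l] with [0 < U i l] form the class of
    [i], and this bounds the oscillation of [x] on each class. *)
Definition class_osc U x (d : R) : Prop :=
  forall i, exists lo, forall l, 0 < U i l -> lo <= x l 0 <= lo + d.

(** Every row [j] in the class of [i] puts weight at least [c] on [i]. Once this weight is split
    off, the term [c * x i] is common to the class, and the remaining mass [1 - c] averages values
    within an interval of length [d]. *)
Lemma class_osc_mulmx U v c x d : stochastic U ->
  supp (U * U) = supp U -> v *m U = v -> (forall i, 0 < v 0 i) ->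
  (forall i j, 0 < U i j -> c <= U i j) ->
  class_osc U x d -> class_osc U (U *m x) ((1 - c) * d).
Proof.
move=> sU UU vU v0 cU xd i; have [U0 U1] := sU.
have [lo lod] := xd i.
exists (c * x i 0 + (1 - c) * lo) => j ij.
have ji : 0 < U j i by exact: supp_idempotent_sym vU v0 ij.
pose b l := U j l - (if l == i then c else 0).
have b0 l : 0 <= b l.
  by rewrite /b; case: eqP => [->|_]; rewrite ?subr0// subr_ge0 cU.
have b1 : \sum_l b l = 1 - c.
  by rewrite sumrB U1 -big_mkcond/= big_pred1_eq.
have bx l : b l * lo <= b l * x l 0 <= b l * (lo + d).
  have [jl|] := boolP (0 < U j l).
    have /lod/andP[lo1 lo2] : 0 < U i l by exact: supp_idempotent_trans ij jl.
    by rewrite !ler_wpM2l.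
  rewrite lt0r U0 andbT negbK => /eqP jl.
  have -> : b l = 0.
    by rewrite /b jl; case: eqP => [li|]; rewrite ?subr0//; rewrite li in jl; rewrite jl ltxx in ji.
  by rewrite !mul0r lexx.
have -> : (U *m x) j 0 = c * x i 0 + \sum_l b l * x l 0.
  rewrite mxE; under [X in _ + X]eq_bigr => l _ do rewrite mulrBl.
  rewrite sumrB [X in _ - X](bigD1 i)//= eqxx [X in _ - (_ + X)]big1 ?addr0.
    by rewrite addrC subrK.
  by move=> l /negbTE ->; rewrite mul0r.
rewrite -addrA -mulrDr !lerD2l -b1 !mulr_suml.
by rewrite !ler_sum// => l _; have /andP[] := bx l.
Qed.

(* Doeblin contraction along the idempotent-support power [W ^+ N]; this makes
   [W ^+ (t + N) - W ^+ t] summable in spite of the possible periodicity. *)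
Lemma power_differences_summable W v : stochastic W ->
  v *m W = v -> (forall i, 0 < v 0 i) ->
  exists N : nat, exists2 C : R, (0 < N)%N & forall (b : R) (g : nat -> 'cV[R]_n.+1) t i,
   0 <= b -> (forall s, (s < t)%N -> forall j, `|g s j 0| <= b) ->
   `|\sum_(s < t) ((W ^+ (s + N) - W ^+ s) *m g s) i 0| <= C * b.
Proof.
move=> sW vW v0; have [N N0 NN] := supp_idempotent_power W sW.
pose U := W ^+ N.
have vX k : v *m W ^+ k = v.
  elim: k => [|k IH]; first by rewrite expr0 mulmx1.
  by rewrite exprS mulmxA vW IH.
have sU : stochastic U by exact: stochasticX.
have UU : supp (U * U) = supp U by rewrite -exprD.
have vU : v *m U = v by exact: vX.
have [c [c0 c1 cU]] := positive_entries_bound U sU.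
have osc (b : R) (g : 'cV[R]_n.+1) k : (forall j, `|g j 0| <= b) ->
    class_osc U (U ^+ k *m g) ((1 - c) ^+ k * (2 * b)).
  move=> gb; elim: k => [|k IH].
    rewrite !expr0 mul1mx mul1r => i; exists (- b) => l _.
    by have := gb l; rewrite ler_norml; lra.
  rewrite !exprS -mulrA -mulmxA.
  by apply: class_osc_mulmx sU UU vU v0 _ IH => // i j /cU.
have dU (b : R) (g : 'cV[R]_n.+1) k i : (forall j, `|g j 0| <= b) ->
    `|((W ^+ (k + N) - W ^+ k) *m g) i 0| <= (1 - c) ^+ (k %/ N) * (2 * b).
  (* Only the power of [U] contracts; the factor with exponent [k %% N] is merely nonexpansive in
     the sup norm. *)
  move=> gb; have -> : (W ^+ (k + N) - W ^+ k) *m g =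
      W ^+ (k %% N) *m (U *m (U ^+ (k %/ N) *m g) - U ^+ (k %/ N) *m g).
    have Wk : W ^+ k = W ^+ (k %% N) *m U ^+ (k %/ N).
      by rewrite mulmxE /U -exprM -exprD mulnC addnC -divn_eq.
    have WkN : W ^+ (k + N) = W ^+ (k %% N) *m (U *m U ^+ (k %/ N)).
      rewrite !mulmxE /U -exprM -!exprD; congr (_ ^+ _).
      by rewrite [in LHS](divn_eq k N) mulnC; lia.
    by rewrite WkN Wk mulmxBr mulmxBl !mulmxA.
  move: i; apply: stochastic_contract; first exact: stochasticX.
  move=> i; have [lo lod] := osc b g (k %/ N)%N gb i.
  set h := U ^+ _ *m g in lod *.
  (* By reflexivity [h i] lies in the same interval as the values averaged by [(U h) i]. *)
  have hii := lod i (supp_idempotent_refl U v i sU UU vU v0).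
  have [U0 U1] := sU.
  have : lo <= (U *m h) i 0 <= lo + (1 - c) ^+ (k %/ N) * (2 * b).
    move: (lo + _) lod => hi lod.
    rewrite mxE; apply/andP; split.
      rewrite -[leLHS]mul1r -(U1 i) !mulr_suml ler_sum// => l _.
      have [/lod/andP[? _]|] := boolP (0 < U i l); first by rewrite ler_wpM2l.
      by rewrite lt0r U0 andbT negbK => /eqP ->; rewrite !mul0r.
    rewrite -[leRHS]mul1r -(U1 i) !mulr_suml ler_sum// => l _.
    have [/lod/andP[_ ?]|] := boolP (0 < U i l); first by rewrite ler_wpM2l.
    by rewrite lt0r U0 andbT negbK => /eqP ->; rewrite !mul0r.
  have -> : (U *m h - h) i 0 = (U *m h) i 0 - h i 0 by rewrite !mxE.
  by move: hii; rewrite ler_norml; lra.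
(* Each exponent [s %/ N] occurs at most [N] times, the geometric series is at most [c^-1], and a
   vector bounded by [b] oscillates by at most [2 * b]. *)
exists N, (N%:R * c^-1 * 2) => // b g t i b0 gb.
apply: le_trans (ler_norm_sum _ _ _) _.
apply: (@le_trans _ _ (\sum_(s < t) (1 - c) ^+ (s %/ N) * (2 * b))).
  by apply: ler_sum => s _; apply: dU; exact: gb.
rewrite -mulr_suml -(mulrA _ 2) ler_wpM2r ?mulr_ge0//.
have c10 : 0 <= 1 - c by lra.
have geo k : \sum_(s < k) (1 - c) ^+ s <= c^-1.
  rewrite -[leRHS]mul1r ler_pdivlMr//.
  have := subrX1 (1 - c) k; have : 0 <= (1 - c) ^+ k by exact: exprn_ge0.
  by set S := \sum_(_ < _) _ => ? ?; rewrite mulrC; lra.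
have blk k : \sum_(s < k * N) (1 - c) ^+ (s %/ N) = N%:R * \sum_(s < k) (1 - c) ^+ s.
  elim: k => [|k IH]; first by rewrite mul0n !big_ord0 mulr0.
  rewrite mulSn addnC big_split_ord/= IH big_ord_recr/= mulrDr; congr (_ + _).
  rewrite (eq_bigr (fun=> (1 - c) ^+ k)) => [|r _]; last first.
    by rewrite divnMDl// divn_small ?addn0.
  by rewrite sumr_const card_ord mulr_natl.
apply: (@le_trans _ _ (\sum_(s < t * N) (1 - c) ^+ (s %/ N))).
  rewrite -(subnKC (leq_pmulr t N0)) big_split_ord/= lerDl sumr_ge0// => s _.
  exact: exprn_ge0.
by rewrite blk ler_wpM2l.
Qed.
End Contraction.

(** * Convergence of averages as sublinear growth *)

Section Sublinear.
Context {R : realType}.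
Implicit Types a b : nat -> R.

(** This is [a t = o(t)] with the initial terms absorbed in [B]: the bound holds for every [t] and
    increases with [t], hence is uniform over all [s < t]. *)
Definition sublinear a : Prop :=
  forall e : R, 0 < e -> exists2 B, 0 <= B & forall t, `|a t| <= e * t%:R + B.

Lemma cvg_sublinear a (l : R) :
  (fun t => a t / t%:R) @ \oo --> l -> sublinear (fun t => a t - l * t%:R).
Proof.
move=> /cvgrPdist_le/= al e e0.
have [N _ HN] := al e e0.
(* The cutoff is [N.+1], so that [t] is nonzero beyond it: at 0 the quotient is 0 by default and
   says nothing about [a 0]. *)
exists (\sum_(t < N.+1) `|a t - l * t%:R|); first exact: sumr_ge0.
move=> t; have [Nt|tN] := leqP N.+1 t; last first.
  rewrite (bigD1 (Ordinal tN))//= addrCA lerDl addr_ge0 ?sumr_ge0//.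
  by rewrite mulr_ge0 ?(ltW e0).
rewrite ler_wpDr ?sumr_ge0//.
have t0 : 0 < t%:R :> R by rewrite ltr0n; lia.
have -> : a t - l * t%:R = (a t / t%:R - l) * t%:R by rewrite mulrBl divfK ?gt_eqF.
by rewrite normrM (gtr0_norm t0) ler_pM2r// distrC; exact: HN (ltnW Nt).
Qed.

Lemma sublinear_cvg a (l : R) : sublinear (fun t => a t - l * t%:R) ->
  (fun t => a t / t%:R) @ \oo --> l.
Proof.
move=> sa; apply/cvgrPdist_le => e e0.
have [B B0 aB] := sa (e / 2) (divr_gt0 e0 (ltr0Sn _ _)).
have [N BN] : exists N : nat, B / (e / 2) < N%:R.
  by exists (Num.trunc (B / (e / 2))).+1; exact: Num.Theory.truncnS_gt.
near=> t.
have t0 : 0 < t%:R :> R by rewrite ltr0n; near: t; exact: nbhs_infty_gt.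
have Nt : (N%:R : R) <= t%:R by rewrite ler_nat; near: t; exact: nbhs_infty_ge.
rewrite distrC -(ler_pM2r t0) -[X in _ * X <= _](gtr0_norm t0) -normrM.
have -> : (a t / t%:R - l) * t%:R = a t - l * t%:R by rewrite mulrBl divfK ?gt_eqF.
have := aB t; have e20 : 0 < e / 2 by lra.
move: BN; rewrite ltr_pdivrMr// => BN.
have : N%:R * (e / 2) <= t%:R * (e / 2) by rewrite ler_pM2r.
lra.
Unshelve. all: by end_near. Qed.

Lemma sublinear_bounded a (B : R) : (forall t, `|a t| <= B) -> sublinear a.
Proof.
move=> aB e e0; exists B; first by apply: le_trans (aB 0%N).
by move=> t; rewrite (le_trans (aB t))// lerDr mulr_ge0// ltW.
Qed.

Lemma sublinearD a b : sublinear a -> sublinear b -> sublinear (fun t => a t + b t).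
Proof.
move=> sa sb e e0; have e20 : 0 < e / 2 by lra.
have [A A0 aA] := sa _ e20; have [B B0 bB] := sb _ e20.
exists (A + B) => [|t]; first by lra.
by rewrite (le_trans (ler_normD _ _))//; have := aA t; have := bB t; lra.
Qed.

End Sublinear.

(** * The linear consensus recursion driven by noise *)

Section WeightedSums.
Context {R : realType} {n : nat}.
Variables (W : 'M[R]_n.+1) (v : 'rV[R]_n.+1).
Hypotheses (sW : stochastic W) (sc : strongly_connected W).
Hypotheses (vW : v *m W = v) (v0 : forall i, 0 <= v 0 i).
Hypothesis (v1 : \sum_i v 0 i = 1).

Lemma stationary_gt0 i : 0 < v 0 i.
Proof.
apply: (invariant_gt0 W v) => //; first by case: sW.
apply/eqP => vE; move: v1; rewrite vE big1 => [/esym/eqP|j _]; rewrite ?mxE//.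
by rewrite oner_eq0.
Qed.

(* Summation by parts along arithmetic progressions of step [N], with [C s] the
   sum of the [m] over the indices congruent to [s] up to [s]. *)
Lemma sublinear_convolution (m : nat -> 'cV[R]_n.+1) :
  (forall N r j, (0 < N)%N ->
    sublinear (fun t => \sum_(s < t) m (r + s * N)%N j 0)) ->
  forall i, sublinear (fun t => (\sum_(s < t) W ^+ s.+1 *m m (t.-1 - s)%N) i 0).
Proof.
move=> sm i.
have [N [D N0 WD]] := power_differences_summable W v sW vW stationary_gt0.
pose C s := \sum_(l < (s %/ N).+1) m (s %% N + l * N)%N.
have CE s : C (s + N)%N = C s + m (s + N)%N.
  rewrite /C divnDr ?dvdnn// divnn N0 addn1 big_ord_recr/= modnDr; congr (_ + m _).
  by rewrite mulSn addnCA [in RHS](divn_eq s N); lia.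
have Cs s : (s < N)%N -> C s = m s.
  by move=> sN; rewrite /C divn_small// big_ord1 modn_small// mul0n addn0.
have Csub e : 0 < e -> exists2 B, 0 <= B & forall s j, `|C s j 0| <= e * s%:R + B.
  move=> e0.
  have /choice[B0 HB0] (p : 'I_N * 'I_n.+1) : exists B, 0 <= B /\
      forall t, `|\sum_(s < t) m (p.1 + s * N)%N p.2 0| <= e * t%:R + B.
    by have [B ? ?] := sm N p.1 p.2 N0 e e0; exists B.
  (* The term [e] accounts for the number of summands of [C s], which is [(s %/ N).+1 <= s + 1]; the
     sum over [p] makes the bound uniform in residue and coordinate. *)
  exists (e + \sum_p B0 p).
    by rewrite addr_ge0 ?(ltW e0)// sumr_ge0// => p _; have [] := HB0 p.
  move=> s j; rewrite /C summxE.
  pose p := (Ordinal (ltn_pmod s N0), j).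
  apply: le_trans ((HB0 p).2 (s %/ N).+1) _.
  have : B0 p <= \sum_p B0 p.
    by rewrite (bigD1 p)//= lerDl sumr_ge0// => q _; have [] := HB0 q.
  have : e * (s %/ N).+1%:R <= e * (s%:R + 1).
    by rewrite ler_pM2l// -natr1 lerD2r ler_nat leq_div.
  lra.
(* Insert [m u = C u - C (u - N)] and shift one sum by [N]: the powers [W ^+ s.+1] with [s < N] stay
   unpaired, and the others pair up into differences of step [N]. *)
have xE t : \sum_(s < t) W ^+ s.+1 *m m (t.-1 - s)%N =
   \sum_(s < minn t N) W ^+ s.+1 *m C (t.-1 - s)%N +
   W *m \sum_(s < t - N) (W ^+ (s + N) - W ^+ s) *m C ((t - N).-1 - s)%N.
  have [tN|Nt] := leqP t N.
    have -> : (t - N = 0)%N by lia.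
    rewrite big_ord0 mulmx0 addr0; apply: eq_bigr => s _.
    by rewrite Cs//; have := ltn_ord s; lia.
  have [T ->] : exists T, t = (N + T)%N by exists (t - N)%N; lia.
  rewrite addKn mulmx_sumr.
  under [X in _ + X]eq_bigr => s _ do
    rewrite mulmxBl mulmxBr !mulmxA !mulmxE -!exprS -addSn (addnC _ N).
  rewrite sumrB addrA.
  have -> : \sum_(s < N) W ^+ s.+1 *m C ((N + T).-1 - s)%N +
     \sum_(s < T) W ^+ (N + s.+1) *m C (T.-1 - s)%N =
     \sum_(s < N + T) W ^+ s.+1 *m C ((N + T).-1 - s)%N.
    rewrite big_split_ord/=; congr (_ + _); apply: eq_bigr => s _.
    by rewrite addnS; congr (_ *m C _); lia.
  rewrite [in RHS]addnC [in LHS]addnC !big_split_ord/= addrAC -sumrB; congr (_ + _).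
    apply: eq_bigr => s _; rewrite -mulmxBr; congr (_ *m _).
    have -> : ((T + N).-1 - s = (T.-1 - s) + N)%N by have := ltn_ord s; lia.
    by rewrite CE addrC addKr.
  by apply: eq_bigr => s _; rewrite Cs//; have := ltn_ord s; lia.
move=> e e0.
have D0 : 0 <= `|D| + N%:R by rewrite addr_ge0.
(* The paired terms cost a factor [D] and each of the at most [N] unpaired ones a factor 1. The
   final 1 keeps the denominator positive, and the absolute value is taken because the sign of [D]
   is not recorded. *)
have d0 : 0 < e / (`|D| + N%:R + 1) by rewrite divr_gt0//; lra.
have [B B0 CB] := Csub _ d0.
exists ((`|D| + N%:R) * B) => [|t]; first by rewrite mulr_ge0.
set d := e / _ in d0 CB; rewrite xE mxE.
have CB' s j : (s < t)%N -> `|C s j 0| <= d * t%:R + B.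
  move=> st; apply: le_trans (CB s j) _.
  by rewrite lerD2r ler_pM2l// ler_nat ltnW.
have b0 : 0 <= d * t%:R + B by rewrite addr_ge0// mulr_ge0// ltW.
apply: (@le_trans _ _ ((`|D| + N%:R) * (d * t%:R + B))); last first.
  rewrite mulrDr lerD2r mulrA ler_wpM2r//.
  by rewrite /d mulrCA ger_pMr// ler_pdivrMr; lra.
rewrite (le_trans (ler_normD _ _))// mulrDl addrC lerD//.
  move: i; apply: stochastic_contract => // i; rewrite summxE.
    have := WD _ (fun s => C ((t - N).-1 - s)%N) (t - N)%N i b0.
  move=> /(_ _)/le_trans -> //; last by rewrite ler_wpM2r// ler_norm.
  by move=> s sT j; apply: CB'; lia.
rewrite summxE (le_trans (ler_norm_sum _ _ _))//.
apply: (@le_trans _ _ (\sum_(s < minn t N) (d * t%:R + B))); last first.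
  by rewrite sumr_const card_ord -[leLHS]mulr_natl ler_wpM2r// ler_nat geq_minr.
apply: ler_sum => s _; move: i; apply: stochastic_contract; first exact: stochasticX.
by move=> i; apply: CB'; have := ltn_ord s; lia.
Qed.

Lemma consensus_average (u z : nat -> 'cV[R]_n.+1) (e : 'cV[R]_n.+1) :
  (forall N r j, (0 < N)%N ->
    (fun t => (\sum_(s < t) u (r + s * N)%N j 0) / t%:R) @ \oo --> e j 0) ->
  (forall t, z t.+1 = W *m (u t + z t)) ->
  forall i, (fun t => z t i 0 / t%:R) @ \oo --> \sum_j v 0 j * e j 0.
Proof.
move=> ue zS i; set eb := \sum_j _.
have W0 : forall i j, 0 <= W i j by case: sW.
have W1 : W *m const_mx 1 = const_mx 1 :> 'cV_n.+1.
  apply/colP => j; rewrite !mxE; under eq_bigr => k _ do rewrite mxE mulr1.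
  by case: sW.
have [g eg] : exists g : 'cV_n.+1, e - eb *: const_mx 1 = g - W *m g.
  apply: (poisson_equation W v _ W0 sc vW stationary_gt0).
  apply/matrixP => a b; rewrite (ord1 a) (ord1 b) mxE [RHS]mxE.
  under eq_bigr => j _ do rewrite !mxE mulr1 mulrBr.
  by rewrite sumrB -mulr_suml v1 mul1r subrr.
pose m t := u t - e.
have m_sub N r j : (0 < N)%N -> sublinear (fun t => \sum_(s < t) m (r + s * N)%N j 0).
  move=> N0; suff -> : (fun t => \sum_(s < t) m (r + s * N)%N j 0) =
      (fun t => \sum_(s < t) u (r + s * N)%N j 0 - e j 0 * t%:R).
    exact/cvg_sublinear/ue.
  apply/funext => t; rewrite /m.
  under eq_bigr => s _ do rewrite !mxE.
  by rewrite sumrB sumr_const card_ord mulr_natr.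
(* With [u] replaced by its mean [e], the sequence [eb * t + W g] solves the recursion, because
   [e + W g = eb + g] and [W] fixes constants. The last term is the homogeneous solution that
   corrects the initial value. *)
have zE t : z t = \sum_(s < t) W ^+ s.+1 *m m (t.-1 - s)%N +
    ((eb * t%:R) *: const_mx 1 + W *m g + W ^+ t *m (z 0%N - W *m g)).
  elim: t => [|t IH].
    by rewrite big_ord0 mulr0 scale0r !add0r expr0 mul1mx addrC subrK.
  have -> : \sum_(s < t.+1) W ^+ s.+1 *m m (t.+1.-1 - s)%N =
      W *m m t + W *m \sum_(s < t) W ^+ s.+1 *m m (t.-1 - s)%N.
    rewrite big_ord_recl subn0 expr1/= mulmx_sumr; congr (_ + _).
    apply: eq_bigr => s _; rewrite mulmxA mulmxE -exprS.
    by congr (_ *m m _); rewrite /bump; lia.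
  have ut : u t = m t + (g - W *m g + eb *: const_mx 1) by rewrite -eg !subrK.
  rewrite zS {1}IH ut (exprS W) -mulmxE -(mulmxA W (W ^+ t)).
  move: (W ^+ t *m _) (\sum_(s < t) _) (m t) => a b c.
  rewrite !mulmxDr !mulmxN -!scalemxAr W1 -natr1.
  move: (W *m c) (W *m g) (W *m (W *m g)) (W *m a) (W *m b) => x1 x2 x3 x4 x5.
  by apply/colP => j; rewrite !mxE; ring.
apply: sublinear_cvg.
have -> : (fun t => z t i 0 - eb * t%:R) = (fun t =>
    (\sum_(s < t) W ^+ s.+1 *m m (t.-1 - s)%N) i 0 +
    (W *m g + W ^+ t *m (z 0%N - W *m g)) i 0).
  apply/funext => t; rewrite zE !(mxE, summxE); ring.
apply: sublinearD; first exact: sublinear_convolution.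
apply: (@sublinear_bounded _ _ (\sum_j `|(W *m g) j 0| + \sum_j `|(z 0%N - W *m g) j 0|)).
move=> t; rewrite mxE (le_trans (ler_normD _ _))// lerD//.
  by rewrite (bigD1 i)//= lerDl sumr_ge0.
move: i; apply: stochastic_contract; first exact: stochasticX.
by move=> j; rewrite (bigD1 j)//= lerDl sumr_ge0.
Qed.

End WeightedSums.

(** * The strong law of large numbers *)

Definition indep_pair {R : realType} {d d1 d2} {Omega : measurableType d}
  {T1 : measurableType d1} {T2 : measurableType d2}
  (P : probability Omega R) (X : Omega -> T1) (Z : Omega -> T2) : Prop :=
  forall A B, measurable A -> measurable B ->
    P (X @^-1` A `&` Z @^-1` B) = (P (X @^-1` A) * P (Z @^-1` B))%E.

Definition same_law {R : realType} {d d1} {Omega : measurableType d}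
  {T1 : measurableType d1}
  (P : probability Omega R) (X Z : Omega -> T1) : Prop :=
  forall A, measurable A -> P (X @^-1` A) = P (Z @^-1` A).

Section Expectation.
Context {R : realType} {d} {Omega : measurableType d} (P : probability Omega R).

Lemma indep_pair_comp {d1 d2 d1' d2'} {T1 : measurableType d1} {T2 : measurableType d2}
  {T1' : measurableType d1'} {T2' : measurableType d2'}
  (X : Omega -> T1) (Z : Omega -> T2) (g : T1 -> T1') (h : T2 -> T2') :
  measurable_fun setT g -> measurable_fun setT h ->
  indep_pair P X Z -> indep_pair P (g \o X) (h \o Z).
Proof.
move=> mg mh XZ A B mA mB; apply: (XZ (g @^-1` A) (h @^-1` B)).
  by rewrite -[X in measurable X]setTI; exact: mg.
by rewrite -[X in measurable X]setTI; exact: mh.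
Qed.

Lemma same_law_comp {d1 d2} {T1 : measurableType d1} {T2 : measurableType d2}
  (X Z : Omega -> T1) (g : T1 -> T2) : measurable_fun setT g ->
  same_law P X Z -> same_law P (g \o X) (g \o Z).
Proof.
move=> mg XZ A mA; apply: (XZ (g @^-1` A)).
by rewrite -[X in measurable X]setTI; exact: mg.
Qed.

Lemma same_law_ge0_integral {d1} {T1 : measurableType d1} (X Z : Omega -> T1)
    (g : T1 -> \bar R) :
  measurable_fun setT X -> measurable_fun setT Z -> same_law P X Z ->
  measurable_fun setT g -> (forall x, 0 <= g x)%E ->
  (\int[P]_w g (X w) = \int[P]_w g (Z w))%E.
Proof.
move=> mX mZ XZ mg g0.
transitivity (\int[pushforward P X]_y g y)%E.
  by rewrite ge0_integral_pushforward// => x _; exact: g0.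
transitivity (\int[pushforward P Z]_y g y)%E.
  by apply: eq_measure_integral => A mA _; exact: XZ.
by rewrite ge0_integral_pushforward// => x _; exact: g0.
Qed.

Lemma indep_ge0_expectationM (X Z : Omega -> R) :
  measurable_fun setT X -> measurable_fun setT Z -> indep_pair P X Z ->
  (forall w, 0 <= X w) -> (forall w, 0 <= Z w) ->
  (\int[P]_w (X w * Z w)%:E = (\int[P]_w (X w)%:E) * (\int[P]_w (Z w)%:E))%E.
Proof.
move=> mX mZ XZ X0 Z0.
pose X' : {RV P >-> R} := HB.pack X (isMeasurableFun.Build _ _ _ _ X mX).
pose Z' : {RV P >-> R} := HB.pack Z (isMeasurableFun.Build _ _ _ _ Z mZ).
(* The absolute values make [h] nonnegative on the whole plane, as Tonelli requires, and change
   nothing at [(X w, Z w)]. *)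
pose h (p : R * R) : \bar R := (`|p.1| * `|p.2|)%:E.
have mh : measurable_fun setT h.
  apply/measurable_EFinP; apply: measurable_funM; apply: measurableT_comp => //.
pose XZm := fun w => (X w, Z w).
have mXZ : measurable_fun setT XZm by exact: measurable_fun_pair.
have h0 p : (0 <= h p)%E by rewrite lee_fin mulr_ge0.
transitivity (\int[pushforward P XZm]_p h p)%E.
  rewrite ge0_integral_pushforward//=.
  by apply: eq_integral => w _; rewrite /h/= !ger0_norm.
transitivity (\int[(distribution P X' \x distribution P Z')%E]_p h p)%E.
  apply/esym/eq_measure_integral => A mA _.
  apply: product_measure_unique => // B C mB mC; exact: XZ.
rewrite fubini_tonelli1//.
transitivity (\int[distribution P X']_x (`|x|%:E * \int[P]_w (Z w)%:E))%E.
  apply: eq_integral => x _; rewrite /fubini_F /h/=.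
  under eq_integral do rewrite EFinM.
  rewrite ge0_integralZl_EFin//; last first.
    by apply/measurable_EFinP; exact: normr_measurable.
  congr (_ * _)%E; rewrite ge0_integral_distribution//; last first.
    by apply/measurable_EFinP; exact: normr_measurable.
  by apply: eq_integral => w _; rewrite /= ger0_norm.
rewrite ge0_integralZr//; first last.
- by apply: integral_ge0 => w _; rewrite lee_fin.
- by apply/measurable_EFinP; exact: normr_measurable.
congr (_ * _)%E; rewrite ge0_integral_distribution//; last first.
  by apply/measurable_EFinP; exact: normr_measurable.
by apply: eq_integral => w _; rewrite /= ger0_norm.
Qed.

(** The series has finite expectation, so it is almost surely finite and its terms tend to 0. This
    does the work of Chebyshev's inequality combined with the Borel-Cantelli lemma. *)
Lemma summable_expectation_ae_cvg0 (g : nat -> Omega -> R) :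
  (forall k, measurable_fun setT (g k)) -> (forall k w, 0 <= g k w) ->
  (\sum_(k <oo) \int[P]_w (g k w)%:E < +oo)%E ->
  {ae P, forall w, (fun k => g k w) @ \oo --> 0}.
Proof.
move=> mg g0; rewrite -integral_nneseries//; last 2 first.
- by move=> k; exact/measurable_EFinP.
- by move=> k w _; rewrite lee_fin.
move=> fin.
have mS : measurable_fun setT (fun w => \sum_(k <oo) (g k w)%:E)%E.
  apply: ge0_emeasurable_sum => [k w _ _|k _]; first by rewrite lee_fin.
  exact/measurable_EFinP.
have S0 w : (0 <= \sum_(k <oo) (g k w)%:E)%E.
  by apply: nneseries_ge0 => k _ _; rewrite lee_fin.
have : P.-integrable setT (fun w => \sum_(k <oo) (g k w)%:E)%E.
  apply/integrableP; split => //.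
  by under eq_integral do rewrite gee0_abs//.
move=> /integrable_ae -/(_ measurableT); apply: filterS => w /(_ I) Sw.
apply: cvg_series_cvg_0; apply: nondecreasing_is_cvgn.
  by apply: nondecreasing_series => k _ _; exact: g0.
exists (fine (\sum_(k <oo) (g k w)%:E)%E) => _ [k _ <-].
rewrite -lee_fin fineK// /series/= -sumEFin.
by apply: nneseries_lim_ge => i _ _; rewrite lee_fin.
Qed.

(** Pairwise independence suffices for variances to add. All integrands are kept nonnegative, so
    that no integrability has to be carried along. *)
Lemma pairwise_indep_variance (G : nat -> Omega -> R) (mu q : R) (N : nat) :
  (forall s, measurable_fun setT (G s)) -> (forall s w, 0 <= G s w) ->
  (forall s t, s != t -> indep_pair P (G s) (G t)) ->
  (forall s, \int[P]_w (G s w)%:E = mu%:E)%E ->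
  (forall s, \int[P]_w (G s w ^+ 2)%:E = q%:E)%E ->
  (\int[P]_w ((\sum_(s < N) G s w - N%:R * mu) ^+ 2)%:E <= (N%:R * q)%:E)%E.
Proof.
move=> mG G0 ind Emu Eq.
have mu0 : 0 <= mu.
  by rewrite -lee_fin -(Emu 0%N); apply: integral_ge0 => w _; rewrite lee_fin.
have q0 : 0 <= q.
  rewrite -lee_fin -(Eq 0%N); apply: integral_ge0 => w _.
  by rewrite lee_fin sqr_ge0.
pose U w := \sum_(s < N) G s w; pose a := N%:R * mu.
have a0 : 0 <= a by rewrite mulr_ge0.
have mU : measurable_fun setT U by exact: measurable_sum.
have U0 w : 0 <= U w by exact: sumr_ge0.
have EU : (\int[P]_w (U w)%:E = a%:E)%E.
  under eq_integral do rewrite -sumEFin.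
  rewrite ge0_integral_sum//; last 2 first.
  - by move=> s; exact/measurable_EFinP.
  - by move=> s w _; rewrite lee_fin.
  under eq_bigr do rewrite Emu.
  by rewrite sumEFin sumr_const card_ord /a mulr_natl.
have EU2 : (\int[P]_w (U w ^+ 2)%:E <= (N%:R * q + a ^+ 2)%:E)%E.
  have -> : (\int[P]_w (U w ^+ 2)%:E =
      \sum_(s < N) \sum_(t < N) \int[P]_w (G s w * G t w)%:E)%E.
    under eq_integral => w _.
      rewrite expr2 /U mulr_suml -sumEFin.
      under eq_bigr do rewrite mulr_sumr -sumEFin.
      over.
    have GG0 s t w : (0 <= (G s w * G t w)%:E)%E by rewrite lee_fin mulr_ge0.
    have mGG s t : measurable_fun setT (fun w => (G s w * G t w)%:E).
      by apply/measurable_EFinP; exact: measurable_funM.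
    rewrite ge0_integral_sum//; last 2 first.
    - by move=> s; apply: emeasurable_sum.
    - by move=> s w _; exact: sume_ge0.
    by apply: eq_bigr => s _; rewrite ge0_integral_sum.
  (* The diagonal terms are enlarged by [mu ^+ 2], so that the products of means add up to exactly
     [a ^+ 2]. *)
  apply: (@le_trans _ _ (\sum_(s < N) \sum_(t < N)
      ((if s == t then q else 0) + mu ^+ 2)%:E)%E).
    apply: lee_sum => s _; apply: lee_sum => t _.
    have [->|st] := eqVneq s t.
      under eq_integral do rewrite -expr2.
      by rewrite Eq lee_fin lerDl sqr_ge0.
    rewrite indep_ge0_expectationM//; last exact: ind.
    by rewrite !Emu -EFinM add0r expr2.
  under eq_bigr do rewrite sumEFin.
  rewrite sumEFin lee_fin.
  have row (s : 'I_N) : \sum_(t < N) ((if s == t then q else 0) + mu ^+ 2) =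
      q + N%:R * mu ^+ 2.
    rewrite big_split/= -big_mkcond/=; congr (_ + _).
      by rewrite (eq_bigl (pred1 s)) ?big_pred1_eq// => t; rewrite /= eq_sym.
    by rewrite sumr_const card_ord mulr_natl.
  under eq_bigr do rewrite row.
  rewrite sumr_const card_ord -[leLHS]mulr_natl /a mulrDr exprMn.
  by rewrite [N%:R ^+ 2]expr2 mulrA.
have mV : measurable_fun setT (fun w => (U w - a) ^+ 2).
  by apply/measurable_funX/measurable_funB.
(* Integrated form of [(U - a)^2 + 2 a U = U^2 + a^2], in which no integral is subtracted. *)
have : (\int[P]_w ((U w - a) ^+ 2)%:E + (2 * a ^+ 2)%:E =
        \int[P]_w (U w ^+ 2)%:E + (a ^+ 2)%:E)%E.
  have -> : (a ^+ 2)%:E = (\int[P]_w (a ^+ 2)%:E)%E.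
    by rewrite integral_cst// [X in (_ * X)%E](_ : _ = 1%E) ?mule1//; exact: probability_setT.
  have -> : (2 * a ^+ 2)%:E = (\int[P]_w (2 * a * U w)%:E)%E.
    under eq_integral do rewrite EFinM.
    rewrite ge0_integralZl_EFin ?mulr_ge0//; [|by move=> w _; rewrite lee_fin|exact/measurable_EFinP].
    by rewrite EU -EFinM; congr EFin; ring.
  have mU2 : measurable_fun setT (fun w => (U w ^+ 2)%:E).
    by apply/measurable_EFinP; exact: measurable_funX.
  have mUa : measurable_fun setT (fun w => (2 * a * U w)%:E).
    by apply/measurable_EFinP; exact: measurable_funM.
  have mV' : measurable_fun setT (fun w => ((U w - a) ^+ 2)%:E).
    exact/measurable_EFinP.
  rewrite -!ge0_integralD//;
    do ?[by move=> w _; rewrite lee_fin ?sqr_ge0 ?mulr_ge0].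
  by apply: eq_integral => w _; rewrite -!EFinD; congr EFin; ring.
move=> E; rewrite -(@leeD2rE _ (2 * a ^+ 2)%:E)// E.
apply: le_trans (leeD2r _ EU2) _.
by rewrite -!EFinD lee_fin; lra.
Qed.

End Expectation.

(** * Dyadic truncation and interpolation *)

Section DyadicSums.
Context {R : realType}.

(** The powers of 2 below [y] add up to less than twice the largest of them. Integrated, this bounds
    the expected numbers of truncated variables, summed over [k]. *)
Lemma dyadic_tail_sum (y : R) n : 0 <= y ->
  \sum_(k < n) 2 ^+ k * \1_`]2 ^+ k, +oo[ y <= 2 * y.
Proof.
move=> y0; elim: n => [|n IH]; first by rewrite big_ord0 mulr_ge0.
rewrite big_ord_recr/= indicE mem_setE in_itv/= andbT.
have [yn|_] := ltP (2 ^+ n) y; last by rewrite mulr0 addr0.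
apply: (@le_trans _ _ (\sum_(k < n.+1) 2 ^+ k)).
  rewrite big_ord_recr/= lerD// ?mulr1// ler_sum// => k _.
  by rewrite ler_piMr ?exprn_ge0// indicE; case: (_ \in _); rewrite ?lexx.
have := subrX1 (2 : R) n.+1; rewrite exprS; set S := \sum_(_ < _) _.
lra.
Qed.

(** Only the [k] with [y <= 2 ^+ k] contribute, and from there on the series is geometric.
    Integrated, this makes the variances of the truncated averages summable. *)
Lemma dyadic_trunc_sum (y : R) n : 0 <= y ->
  \sum_(k < n) (2 ^+ k)^-1 * (y * \1_`]-oo, 2 ^+ k] y) ^+ 2 <= 2 * y.
Proof.
move=> y0.
pose G m := \sum_(k < m) (2 ^+ k)^-1 * (y * \1_`]-oo, 2 ^+ k] y) ^+ 2.
rewrite -/(G n).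
have step m : G m.+1 = G m + (2 ^+ m)^-1 * (y * \1_`]-oo, 2 ^+ m] y) ^+ 2.
  by rewrite /G big_ord_recr.
(* The subtracted term is the sum of the geometric tail from [n] on, which lets the induction
   close. *)
suff [H1 H2] : (y <= 2 ^+ n -> G n <= 2 * y - 2 * y ^+ 2 * (2 ^+ n)^-1) /\
    (2 ^+ n < y -> G n = 0).
  have [/H1|/H2 ->] := leP y (2 ^+ n); last by rewrite mulr_ge0.
  by move=> /le_trans; apply; rewrite gerBl !mulr_ge0// ?sqr_ge0// invr_ge0 exprn_ge0.
elim: n => [|n [IH1 IH2]].
  rewrite /G big_ord0 expr0 invr1; split=> // y1; nra.
have p0 : 0 < 2 ^+ n :> R by rewrite exprn_gt0.
have V2 : (2 ^+ n.+1)^-1 = 2^-1 * (2 ^+ n)^-1 :> R by rewrite exprS invfM.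
rewrite step indicE mem_setE in_itv/= V2.
split=> [yn|]; last first.
  rewrite exprS => yn; have yn' : 2 ^+ n < y by lra.
  by rewrite leNgt yn' mulr0 expr0n/= mulr0 addr0 IH2.
have [yn'|yn'] := leP y (2 ^+ n).
  by have := IH1 yn'; rewrite mulr1; lra.
rewrite IH2// mulr0 expr0n/= mulr0 addr0.
have : y * (2 ^+ n)^-1 <= 2 by rewrite ler_pdivrMr// -exprS.
nra.
Qed.

(** A large [n] lies between [j * 2 ^ k] and [j.+1 * 2 ^ k] with [Q <= j < 2 * Q]. These ends differ
    by a factor at most [1 + 1/Q], and as only finitely many [j] occur, the convergence is uniform
    in [j]. *)
Lemma dyadic_monotone_cvg (S : nat -> R) (e : R) : 0 <= e ->
  {homo S : m n / (m <= n)%N >-> m <= n} ->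
  (forall j, (0 < j)%N ->
     (fun k => S (j * 2 ^ k)%N / (j * 2 ^ k)%:R) @ \oo --> e) ->
  (fun n => S n / n%:R) @ \oo --> e.
Proof.
move=> e0 Smono Se; apply/cvgrPdist_le => eps eps0.
pose d := eps / 2; have d0 : 0 < d by rewrite /d; lra.
(* At least [Q] blocks of length [2 ^ k] fit below [n], so one block more changes the bound by at
   most [(e + d) * n / Q <= d * n]. *)
pose Q := (Num.trunc ((e + d) / d)).+1.
have Qd : e + d <= d * Q%:R.
  by rewrite mulrC -ler_pdivrMr// ltW// Num.Theory.truncnS_gt.
have : \forall k \near \oo, forall j : 'I_(2 * Q).+1, (0 < j)%N ->
    `|e - S (j * 2 ^ k)%N / (j * 2 ^ k)%:R| <= d.
  apply: filter_forall => j; have [j0|] := ltnP 0%N j; last first.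
    by move=> ?; near=> k => ?; lia.
  by move/cvgrPdist_le: (Se j j0) => /(_ d d0); apply: filterS.
move=> [k0 _ Hk0].
exists (Q * 2 ^ k0)%N => // n /= nQ.
(* The largest [k] with [Q * 2 ^ k <= n], which puts [j] in the required range. *)
pose k := trunc_log 2 (n %/ Q); pose j := (n %/ 2 ^ k)%N.
have nQ0 : (2 ^ k0 <= n %/ Q)%N by rewrite leq_divRL// mulnC.
have nQ1 : (0 < n %/ Q)%N by apply: leq_trans nQ0; rewrite expn_gt0.
have k0k : (k0 <= k)%N by exact: trunc_log_max.
have /andP[kl ku] : (2 ^ k <= n %/ Q < 2 ^ k.+1)%N by exact: trunc_log_bounds.
have pk : (0 < 2 ^ k)%N by rewrite expn_gt0.
have jQ : (Q <= j)%N by rewrite /j leq_divRL// mulnC -leq_divRL.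
have jQ2 : (j < 2 * Q)%N.
  by rewrite /j ltn_divLR// -mulnA mulnCA -expnS mulnC -ltn_divLR// mulnC.
have an : (j * 2 ^ k <= n)%N by exact: leq_trunc_div.
have nb : (n < j.+1 * 2 ^ k)%N by rewrite -ltn_divLR.
have pkn : (Q * 2 ^ k <= n)%N by apply: leq_trans an; rewrite leq_mul2r jQ orbT.
have j0 : (0 < j)%N by lia.
have n0 : 0 < n%:R :> R by rewrite ltr0n; nia.
have lowj : (e - d) * (j * 2 ^ k)%:R <= S (j * 2 ^ k)%N.
  have jlt : (j < (2 * Q).+1)%N by lia.
  have := Hk0 k k0k (Ordinal jlt) j0; rewrite /= => H.
  have p : 0 < (j * 2 ^ k)%:R :> R by rewrite ltr0n muln_gt0 j0.
  by rewrite -ler_pdivlMr//; move: H; rewrite ler_norml; lra.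
have upj : S (j.+1 * 2 ^ k)%N <= (e + d) * (j.+1 * 2 ^ k)%:R.
  have jlt : (j.+1 < (2 * Q).+1)%N by lia.
  have H : `|e - S (j.+1 * 2 ^ k)%N / (j.+1 * 2 ^ k)%:R| <= d :=
    Hk0 k k0k (Ordinal jlt) isT.
  have p : 0 < (j.+1 * 2 ^ k)%:R :> R by rewrite ltr0n muln_gt0.
  by rewrite -ler_pdivrMr//; move: H; rewrite ler_norml; move: (_ / _) => z; lra.
have Sn1 := Smono _ _ an; have Sn2 := Smono _ _ (ltnW nb).
have En : S n = S n / n%:R * n%:R by rewrite divfK// gt_eqF.
set x := S n / n%:R in En *.
have anR : (j * 2 ^ k)%:R <= n%:R :> R by rewrite ler_nat.
have nbR : n%:R <= (j * 2 ^ k)%:R + (2 ^ k)%:R :> R.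
  by rewrite -natrD ler_nat addnC -mulSn ltnW.
have bR : Q%:R * (2 ^ k)%:R <= n%:R :> R by rewrite -natrM ler_nat.
rewrite mulSn natrD in upj.
move: (j * 2 ^ k)%:R (2 ^ k)%:R (ler0n R (2 ^ k)) anR nbR bR upj lowj => A B B0 anR nbR bR upj lowj.
have dB : (e + d) * B <= d * n%:R.
  apply: le_trans (_ : d * (Q%:R * B) <= _); last by rewrite ler_pM2l.
  by rewrite mulrA ler_wpM2r.
rewrite -(ler_pM2r n0) -[X in _ * X <= _](gtr0_norm n0) -normrM mulrBl -En.
rewrite ler_norml /=.
have -> : eps = 2 * d by rewrite /d; lra.
have eB : e * (n%:R - A) <= e * B by rewrite ler_wpM2l//; lra.
have dA : d * A <= d * n%:R by rewrite ler_pM2l.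
have eA : e * A <= e * n%:R by rewrite ler_wpM2l.
have dB0 : 0 <= d * B by rewrite mulr_ge0// ltW.
by apply/andP; split; lra.
Unshelve. all: by end_near. Qed.

End DyadicSums.

Lemma sqr_cvg0 {R : realType} (u : nat -> R) :
  (fun k => u k ^+ 2) @ \oo --> 0 -> u @ \oo --> 0.
Proof.
move=> /cvgrPdist_le u2; apply/cvgrPdist_le => e e0.
have := u2 (e ^+ 2) (exprn_gt0 2 e0); apply: filterS => k.
by rewrite !sub0r !normrN normrX ler_pXn2r ?nnegrE ?normr_ge0 ?(ltW e0)//.
Qed.

Section StrongLaw.
Context {R : realType} {d} {Omega : measurableType d} (P : probability Omega R).

Section Nonneg.
Variables (Y : nat -> Omega -> R) (e : R).
Hypotheses (mY : forall n, measurable_fun setT (Y n)) (Y0 : forall n w, 0 <= Y n w).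
Hypotheses (Yid : forall n, same_law P (Y n) (Y 0)).
Hypothesis (Yind : forall m n, m != n -> indep_pair P (Y m) (Y n)).
Hypothesis (Ye : (\int[P]_w (Y 0 w)%:E = e%:E)%E).

(* For partial sums of length [j * 2 ^ k] the variables are truncated at [2 ^ k].
   Letting [j] vary makes the ratios of consecutive lengths as close to 1 as needed
   to interpolate, so no other geometric subsequence is required. *)
Let tr k (y : R) : R := y * \1_`]-oo, 2 ^+ k] y.
Let tl k (y : R) : R := \1_`]2 ^+ k, +oo[ y.

Let mtr k : measurable_fun setT (tr k).
Proof. by apply: measurable_funM => //; apply: measurable_indic. Qed.

Let mtl k : measurable_fun setT (tl k).
Proof. exact: measurable_indic. Qed.

Let trE k y : tr k y = if y <= 2 ^+ k then y else 0.
Proof. by rewrite /tr indicE mem_setE in_itv/=; case: ifP; rewrite ?mulr1 ?mulr0. Qed.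

Let tlE k y : tl k y = (2 ^+ k < y)%R%:R.
Proof. by rewrite /tl indicE mem_setE in_itv/= andbT. Qed.

Let tr_ge0 k y : 0 <= y -> 0 <= tr k y.
Proof. by rewrite trE; case: ifP. Qed.

Let same_expectation (g : R -> R) n : measurable_fun setT g -> (forall y, 0 <= y -> 0 <= g y) ->
  (\int[P]_w (g (Y n w))%:E = \int[P]_w (g (Y 0 w))%:E)%E.
Proof.
move=> mg g0.
have H k : (\int[P]_w (g (Y k w))%:E = \int[P]_w (g `|Y k w|)%:E)%E.
  by apply: eq_integral => w _; rewrite ger0_norm.
rewrite !H; apply: (@same_law_ge0_integral _ _ _ P _ _ (Y n) (Y 0) (fun y => (g `|y|)%:E)) => //.
  by apply/measurable_EFinP; apply: measurableT_comp => //; exact: normr_measurable.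
by move=> x; rewrite lee_fin g0.
Qed.

Let summable_dominated (h : nat -> R -> R) (C : R) :
  (forall k, measurable_fun setT (h k)) -> (forall k y, 0 <= y -> 0 <= h k y) ->
  (forall n y, 0 <= y -> \sum_(k < n) h k y <= C * y) ->
  (\sum_(k <oo) \int[P]_w (h k (Y 0 w))%:E < +oo)%E.
Proof.
move=> mh h0 hC.
have mhY k : measurable_fun setT (fun w => (h k (Y 0 w))%:E).
  by apply/measurable_EFinP; exact: measurableT_comp.
rewrite -integral_nneseries//; last by move=> k w _; rewrite lee_fin h0.
have hC' w : (\sum_(k <oo) (h k (Y 0 w))%:E <= (C * Y 0 w)%:E)%E.
  apply: lime_le; first by apply: is_cvg_nneseries => k _ _; rewrite lee_fin h0.
  by apply: nearW => n; rewrite sumEFin lee_fin big_mkord hC.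
have S0 w : (0 <= \sum_(k <oo) (h k (Y 0 w))%:E)%E.
  by apply: nneseries_ge0 => k _ _; rewrite lee_fin h0.
apply: (@le_lt_trans _ _ (\int[P]_w (`|C| * Y 0 w)%:E)%E); last first.
  under eq_integral do rewrite EFinM.
  rewrite ge0_integralZl_EFin//; last 2 first.
  - by move=> w _; rewrite lee_fin.
  - exact/measurable_EFinP.
  by rewrite Ye -EFinM ltry.
apply: ge0_le_integral => //.
- apply: ge0_emeasurable_sum => [k w _ _|k _]; first by rewrite lee_fin h0.
  exact: mhY.
- by apply/measurable_EFinP; exact: measurable_funM.
- by move=> w _; apply: le_trans (hC' w) _; rewrite lee_fin ler_wpM2r// ler_norm.
Qed.

Let mu k : R := fine (\int[P]_w (tr k (Y 0 w))%:E)%E.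
Let q k : R := fine (\int[P]_w (tr k (Y 0 w) ^+ 2)%:E)%E.

Let muE k : (\int[P]_w (tr k (Y 0 w))%:E = (mu k)%:E)%E.
Proof.
rewrite /mu fineK// ge0_fin_numE; last first.
  by apply: integral_ge0 => w _; rewrite lee_fin tr_ge0.
apply: (@le_lt_trans _ _ (\int[P]_w (Y 0 w)%:E)%E); last by rewrite Ye ltry.
apply: ge0_le_integral => //.
- by move=> w _; rewrite lee_fin tr_ge0.
- by apply/measurable_EFinP; exact: measurableT_comp.
- exact/measurable_EFinP.
- by move=> w _; rewrite lee_fin trE; case: ifP.
Qed.

Let qE k : (\int[P]_w (tr k (Y 0 w) ^+ 2)%:E = (q k)%:E)%E.
Proof.
rewrite /q fineK// ge0_fin_numE; last first.
  by apply: integral_ge0 => w _; rewrite lee_fin sqr_ge0.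
apply: (@le_lt_trans _ _ (\int[P]_w (2 ^+ k * Y 0 w)%:E)%E); last first.
  under eq_integral do rewrite EFinM.
  rewrite ge0_integralZl_EFin ?exprn_ge0//; last 2 first.
  - by move=> w _; rewrite lee_fin.
  - exact/measurable_EFinP.
  by rewrite Ye -EFinM ltry.
apply: ge0_le_integral => //.
- by move=> w _; rewrite lee_fin sqr_ge0.
- apply/measurable_EFinP; apply: measurable_funX.
  exact: measurableT_comp.
- by apply/measurable_EFinP; exact: measurable_funM.
- move=> w _; rewrite lee_fin trE; case: ifP => yk.
    by rewrite expr2 ler_wpM2r.
  by rewrite expr0n/= mulr_ge0// exprn_ge0.
Qed.

Let mu_cvg : mu @ \oo --> e.
Proof.
have : (\int[P]_w (tr k (Y 0 w))%:E)%E @[k --> \oo] --> (\int[P]_w (Y 0 w)%:E)%E.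
  have trlim w : (tr k (Y 0 w))%:E @[k --> \oo] --> (Y 0 w)%:E.
    apply: cvg_near_cst; near=> k; rewrite trE ifT//.
    rewrite (@le_trans _ _ k%:R)//.
      near: k; exact: nbhs_infty_ger.
    by rewrite -natrX ler_nat ltnW// ltn_expl.
  have -> : (\int[P]_w (Y 0 w)%:E = \int[P]_w limn (fun k => (tr k (Y 0 w))%:E))%E.
    by apply: eq_integral => w _; apply/esym/cvg_lim => //; exact: trlim.
  apply: cvg_monotone_convergence => //.
  - by move=> k; apply/measurable_EFinP; exact: measurableT_comp.
  - by move=> k w _; rewrite lee_fin tr_ge0.
  - move=> w _ a b ab; rewrite lee_fin !trE.
    have pab : 2 ^+ a <= 2 ^+ b :> R by rewrite ler_weXn2l// ler1n.
    case: ifP => [ya|_]; first by rewrite (le_trans ya pab).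
    by case: ifP.
rewrite Ye; under eq_fun do rewrite muE.
by move/fine_cvgP => [_].
Unshelve. all: by end_near. Qed.

(** [gv] is the squared deviation of the truncated average from its mean, and [gd] counts the
    variables that are cut off. Both have summable expectations; as [gd] takes integer values, its
    tending to 0 means that eventually nothing is cut off. *)
Let dyadic_slln j : (0 < j)%N -> {ae P, forall w,
  (fun k => (\sum_(s < j * 2 ^ k) Y s w) / (j * 2 ^ k)%:R) @ \oo --> e}.
Proof.
move=> j0.
pose M k : R := (j * 2 ^ k)%:R.
have M0 k : 0 < M k by rewrite ltr0n muln_gt0 j0 expn_gt0.
pose gv k w := ((\sum_(s < j * 2 ^ k) tr k (Y s w)) / M k - mu k) ^+ 2.
pose gd k w := \sum_(s < j * 2 ^ k) tl k (Y s w).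
have mtrY k s : measurable_fun setT (fun w => tr k (Y s w)).
  exact: measurableT_comp.
have mtlY k s : measurable_fun setT (fun w => tl k (Y s w)).
  exact: measurableT_comp.
have p0 k : 0 < 2 ^+ k :> R by rewrite exprn_gt0.
have gv0 : {ae P, forall w, (fun k => gv k w) @ \oo --> 0}.
  have msum k : measurable_fun setT (fun w => \sum_(s < j * 2 ^ k) tr k (Y s w)).
    exact: measurable_sum.
  apply: summable_expectation_ae_cvg0.
  - move=> k; apply/measurable_funX/measurable_funB => //.
    by apply: measurable_funM.
  - by move=> k w; exact: sqr_ge0.
  apply: (@le_lt_trans _ _
      (\sum_(k <oo) \int[P]_w ((2 ^+ k)^-1 * tr k (Y 0 w) ^+ 2)%:E)%E); last first.
    apply: (summable_dominated (fun k y => (2 ^+ k)^-1 * tr k y ^+ 2) 2).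
    - by move=> k; apply: measurable_funM => //; exact: measurable_funX.
    - by move=> k y y0; rewrite mulr_ge0 ?invr_ge0 ?sqr_ge0// ltW.
    - by move=> n y y0; exact: dyadic_trunc_sum.
  apply: lee_nneseries => [k _ _|k _].
    by apply: integral_ge0 => w _; rewrite lee_fin sqr_ge0.
  have V : (\int[P]_w ((\sum_(s < j * 2 ^ k) tr k (Y s w) - M k * mu k) ^+ 2)%:E <=
      (M k * q k)%:E)%E.
    apply: (pairwise_indep_variance P (fun s w => tr k (Y s w))) => //.
    - by move=> s w; exact: tr_ge0.
    - by move=> s t st; apply: indep_pair_comp (Yind s t st).
    - by move=> s; rewrite -muE; apply: same_expectation => // y; exact: tr_ge0.
    - move=> s; rewrite -qE; apply: (same_expectation (fun y => tr k y ^+ 2)).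
        exact: measurable_funX.
      by move=> y _; exact: sqr_ge0.
  have -> : (\int[P]_w (gv k w)%:E = (M k ^- 2)%:E *
      \int[P]_w ((\sum_(s < j * 2 ^ k) tr k (Y s w) - M k * mu k) ^+ 2)%:E)%E.
    rewrite -ge0_integralZl_EFin//.
    - apply: eq_integral => w _; rewrite -EFinM; congr EFin.
      by rewrite /gv; move: (M k) (M0 k) => x x0; field; rewrite gt_eqF.
    - by move=> w _; rewrite lee_fin sqr_ge0.
    - by apply/measurable_EFinP/measurable_funX/measurable_funB.
    - by rewrite invr_ge0 exprn_ge0 ?ltW.
  under [leRHS]eq_integral do rewrite EFinM.
  have V0 : 0 <= (2 ^+ k)^-1 :> R by rewrite invr_ge0 ltW.
  have mV : measurable_fun setT (fun w => (tr k (Y 0 w) ^+ 2)%:E).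
    by apply/measurable_EFinP/measurable_funX.
  rewrite [leRHS]ge0_integralZl_EFin//; last by move=> w _; rewrite lee_fin sqr_ge0.
  rewrite qE.
  apply: (@le_trans _ _ ((M k ^- 2)%:E * (M k * q k)%:E)%E).
    by rewrite lee_wpmul2l// lee_fin invr_ge0 exprn_ge0// ltW.
  rewrite -!EFinM lee_fin.
  have q0 : 0 <= q k.
    by rewrite -lee_fin -qE; apply: integral_ge0 => w _; rewrite lee_fin sqr_ge0.
  have -> : M k ^- 2 * (M k * q k) = (M k)^-1 * q k.
    by move: (M k) (M0 k) => x x0; field; rewrite gt_eqF.
  rewrite ler_wpM2r// lef_pV2 ?posrE// /M natrM natrX ler_peMl ?ler1n//.
have gd0 : {ae P, forall w, (fun k => gd k w) @ \oo --> 0}.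
  apply: summable_expectation_ae_cvg0.
  - by move=> k; exact: measurable_sum.
  - by move=> k w; apply: sumr_ge0 => s _; rewrite tlE.
  apply: (@le_lt_trans _ _
      (\sum_(k <oo) \int[P]_w (j%:R * (2 ^+ k * tl k (Y 0 w)))%:E)%E); last first.
    apply: (summable_dominated (fun k y => j%:R * (2 ^+ k * tl k y)) (j%:R * 2)).
    - by move=> k; do 2 apply: measurable_funM => //.
    - by move=> k y y0; rewrite !mulr_ge0// ?tlE// ltW.
    - move=> n y y0; rewrite -mulr_sumr -mulrA ler_wpM2l//.
      exact: dyadic_tail_sum.
  apply: lee_nneseries => [k _ _|k _].
    by apply: integral_ge0 => w _; rewrite lee_fin sumr_ge0// => s _; rewrite tlE.
  under eq_integral do rewrite -sumEFin.
  rewrite ge0_integral_sum//; last 2 first.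
  - by move=> s; exact/measurable_EFinP.
  - by move=> s w _; rewrite lee_fin tlE.
  have tlid s : (\int[P]_w (tl k (Y s w))%:E = \int[P]_w (tl k (Y 0 w))%:E)%E.
    by apply: same_expectation => // y _; rewrite tlE.
  under eq_bigr do rewrite tlid.
  under [leRHS]eq_integral do rewrite mulrA EFinM.
  have V0 : 0 <= j%:R * 2 ^+ k :> R by rewrite mulr_ge0// ltW.
  have mV : measurable_fun setT (fun w => (tl k (Y 0 w))%:E).
    exact/measurable_EFinP.
  rewrite [leRHS]ge0_integralZl_EFin//; last by move=> w _; rewrite lee_fin tlE.
  rewrite sumr_const card_ord -natrX -natrM.
  by rewrite mule_natl.
move: gv0 gd0; apply: filterS2 => w gvw gdw.
have {}gvw := sqr_cvg0 _ gvw.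
have : (fun k => (\sum_(s < j * 2 ^ k) tr k (Y s w)) / M k) @ \oo --> e.
  rewrite -[e]add0r.
  apply: cvg_trans (cvgD gvw mu_cvg); apply: near_eq_cvg.
  by near=> k; rewrite /= subrK.
apply: cvg_trans; apply: near_eq_cvg; near=> k; congr (_ / _).
apply: eq_bigr => s _; rewrite trE ifT// leNgt.
apply/negP => ys.
have : gd k w < 1.
  have : `|0 - gd k w| < 1.
    by near: k; move/cvgrPdist_lt: gdw; apply.
  by rewrite sub0r normrN; apply: le_lt_trans; exact: ler_norm.
by rewrite /gd (bigD1 s)//= tlE ys ltNge lerDl sumr_ge0// => t _; rewrite tlE.
Unshelve. all: by end_near. Qed.

Lemma slln_ge0 : {ae P, forall w, (fun n => (\sum_(s < n) Y s w) / n%:R) @ \oo --> e}.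
Proof.
have /ae_foralln : forall j, {ae P, forall w, (0 < j)%N ->
    (fun k => (\sum_(s < j * 2 ^ k) Y s w) / (j * 2 ^ k)%:R) @ \oo --> e}.
  move=> j; have [j0|] := ltnP 0%N j; last by move=> ?; apply: aeW.
  by have := dyadic_slln j j0; apply: filterS.
apply: filterS => w Hw.
apply: (@dyadic_monotone_cvg _ (fun n => \sum_(s < n) Y s w)) => //.
- by rewrite -lee_fin -Ye; apply: integral_ge0 => x _; rewrite lee_fin.
- move=> m n mn /=; rewrite -(subnKC mn) big_split_ord/= lerDl.
  exact: sumr_ge0.
Qed.

End Nonneg.

Lemma slln (Y : nat -> Omega -> R) :
  (forall n, measurable_fun setT (Y n)) ->
  (forall n, same_law P (Y n) (Y 0)) ->
  (forall m n, m != n -> indep_pair P (Y m) (Y n)) ->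
  P.-integrable setT (EFin \o Y 0) ->
  {ae P, forall w, (fun n => (\sum_(s < n) Y s w) / n%:R) @ \oo -->
     fine (\int[P]_w (Y 0 w)%:E)%E}.
Proof.
move=> mY Yid Yind iY.
pose pos (y : R) := Num.max y 0; pose neg (y : R) := Num.max (- y) 0.
have mpos : measurable_fun setT pos by apply: measurable_maxr.
have mneg : measurable_fun setT neg.
  by apply: measurable_maxr => //; exact: oppr_measurable.
have pos0 y : 0 <= pos y by rewrite le_max lexx orbT.
have neg0 y : 0 <= neg y by rewrite le_max lexx orbT.
have posneg y : y = pos y - neg y by rewrite /pos /neg; case: leP => ?; case: leP => ?; lra.
have pos_le y : pos y <= `|y| by rewrite ge_max ler_norm normr_ge0.
have neg_le y : neg y <= `|y| by rewrite ge_max -normrN ler_norm normr_ge0.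
have part (h : R -> R) : measurable_fun setT h -> (forall y, 0 <= h y) ->
    (forall y, h y <= `|y|) ->
    P.-integrable setT (fun w => (h (Y 0 w))%:E) /\ {ae P, forall w, (fun n => (\sum_(s < n) h (Y s w)) / n%:R) @ \oo -->
     fine (\int[P]_w (h (Y 0 w))%:E)%E}.
  move=> mh h0 hle.
  have ih : P.-integrable setT (fun w => (h (Y 0 w))%:E).
    apply: le_integrable iY => //.
      by apply/measurable_EFinP; exact: measurableT_comp.
    by move=> w _; rewrite /= lee_fin ger0_norm.
  split => //; apply: (slln_ge0 (fun s w => h (Y s w))).
  - by move=> n; exact: measurableT_comp.
  - by move=> n w; exact: h0.
  - by move=> n; exact: same_law_comp (Yid n).
  - by move=> m n mn; exact: indep_pair_comp (Yind m n mn).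
  - by rewrite fineK//; exact: integrable_fin_num.
have [ip cp] := part pos mpos pos0 pos_le.
have [ineg cn] := part neg mneg neg0 neg_le.
move: cp cn; apply: filterS2 => w cp cn.
have -> : fine (\int[P]_w (Y 0 w)%:E)%E =
   fine (\int[P]_w (pos (Y 0 w))%:E)%E - fine (\int[P]_w (neg (Y 0 w))%:E)%E.
  rewrite -fineB; try exact: integrable_fin_num.
  rewrite -integralB//; congr fine; apply: eq_integral => x _.
  by rewrite /= -EFinB -posneg.
apply: cvg_trans (cvgB cp cn); apply: near_eq_cvg; apply: nearW => n /=.
transitivity ((\sum_(s < n) pos (Y s w)) / n%:R - (\sum_(s < n) neg (Y s w)) / n%:R) => //.
rewrite -mulrBl -sumrB; congr (_ / _); apply: eq_bigr => s _.
by rewrite -posneg.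
Qed.

End StrongLaw.

(** * Belief ratios *)

Section Beliefs.
Context {R : realType} {n m : nat} (W : 'M[R]_n).
Hypothesis W0 : forall i j, 0 <= W i j.

(** The conventions of both sides agree at [b = 0]: the value is 1 for weight 0 and 0 for positive
    weight. *)
Lemma expeR_mul_lne (w b : R) : 0 <= w -> 0 <= b ->
  expeR (w%:E * lne b%:E) = (b `^ w)%:E.
Proof.
move=> w0 b0; have [->|bn0] := eqVneq b 0.
  rewrite le0_lneNy//; have [->|wn0] := eqVneq w 0.
    by rewrite mul0e expeR0 powRr0.
  by rewrite gt0_muleNy ?lte_fin ?lt0r ?wn0// powR0.
by rewrite lne_EFin ?lt0r ?bn0// -EFinM /= /powR (negbTE bn0).
Qed.

Lemma consensus_weight (b : 'I_n -> 'I_m.+1 -> R) i k : (forall j k, 0 <= b j k) ->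
  fine (expeR (consensus_exponent W b i k)) = \prod_(j < n) b j k `^ W i j.
Proof.
move=> b0; rewrite /consensus_exponent.
have -> : expeR (\sum_(j < n) (W i j)%:E * lne (b j k)%:E)%E =
    (\prod_(j < n) b j k `^ W i j)%:E.
  elim/big_ind2 : _ => [|x1 x2 y1 y2 IH1 IH2|j _]; first exact: expeR0.
    by rewrite expeRD IH1 IH2 EFinM.
  exact: expeR_mul_lne.
by [].
Qed.

Context {T : 'I_n -> Type} (f : forall i : 'I_n, 'I_m.+1 -> T i -> R).
Variables (q0 : 'I_n -> 'I_m.+1 -> R) (x : nat -> forall i : 'I_n, T i).
Hypotheses (f0 : forall i k y, 0 <= f i k y).
Hypotheses (q00 : forall i k, 0 < q0 i k) (q01 : forall i, \sum_k q0 i k = 1).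
Hypothesis (fM : forall t j, 0 < f j ord_max (x t j)).

Let q := belief f W q0 x.
Let b t j := bayes_update (fun k => f j k (x t j)) (q t j).

Let bE t j k : b t j k = f j k (x t j) * q t j k / \sum_(a < m.+1) f j a (x t j) * q t j a.
Proof. by []. Qed.

Let bayes_den t j : (forall k, 0 <= q t j k) -> 0 < q t j ord_max ->
  0 < \sum_(a < m.+1) f j a (x t j) * q t j a.
Proof.
move=> Q0 QM; rewrite (bigD1 ord_max)//= ltr_pwDl ?mulr_gt0//.
by rewrite sumr_ge0// => a _; rewrite mulr_ge0.
Qed.

Let bayes_ge0 t j k : (forall k, 0 <= q t j k) -> 0 < q t j ord_max -> 0 <= b t j k.
Proof.
by move=> Q0 QM; rewrite bE mulr_ge0// ?mulr_ge0// invr_ge0 ltW// bayes_den.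
Qed.

Let bayes_gt0 t j : (forall k, 0 <= q t j k) -> 0 < q t j ord_max -> 0 < b t j ord_max.
Proof. by move=> Q0 QM; rewrite bE divr_gt0 ?mulr_gt0// bayes_den. Qed.

Let beliefS t i k : q t.+1 i k = fine (expeR (consensus_exponent W (b t) i k)) /
             \sum_(a < m.+1) fine (expeR (consensus_exponent W (b t) i a)).
Proof. by []. Qed.

(** Positivity is kept for the true hypothesis only: an observation of likelihood 0 may reduce the
    belief in another one to 0. *)
Lemma belief_distr t : [/\ forall i k, 0 <= belief f W q0 x t i k,
  forall i, 0 < belief f W q0 x t i ord_max &
  forall i, \sum_k belief f W q0 x t i k = 1].
Proof.
elim: t => [|t [IH0 IHM _]].
  by split=> [i k|i|i] /=; [exact: ltW| |].
have B0 j k : 0 <= b t j k by exact: bayes_ge0.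
have BM j : 0 < b t j ord_max by exact: bayes_gt0.
have N0 i k : 0 <= \prod_(j < n) b t j k `^ W i j.
  by apply: prodr_ge0 => j _; exact: powR_ge0.
have NM i : 0 < \prod_(j < n) b t j ord_max `^ W i j.
  by apply: prodr_gt0 => j _; exact: powR_gt0.
have D0 i : 0 < \sum_(a < m.+1) \prod_(j < n) b t j a `^ W i j.
  by rewrite (bigD1 ord_max)//= ltr_pwDl// sumr_ge0.
have qE i k : q t.+1 i k = (\prod_(j < n) b t j k `^ W i j) /
    \sum_(a < m.+1) \prod_(j < n) b t j a `^ W i j.
  rewrite beliefS consensus_weight//; congr (_ / _); apply: eq_bigr => a _.
  by rewrite consensus_weight.
rewrite -/q; split=> [i k|i|i].
- by rewrite qE divr_ge0// ltW.
- by rewrite qE divr_gt0.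
- under eq_bigr do rewrite qE.
  by rewrite -mulr_suml divff// gt_eqF.
Qed.

(** A product of powers rather than an identity between logarithms, so that it stays valid when the
    ratio vanishes. *)
Lemma belief_ratioS t i k :
  belief f W q0 x t.+1 i k / belief f W q0 x t.+1 i ord_max =
  \prod_(j < n) (f j k (x t j) / f j ord_max (x t j) *
    (belief f W q0 x t j k / belief f W q0 x t j ord_max)) `^ W i j.
Proof.
have [Q0 QM _] := belief_distr t.
have B0 j a : 0 <= b t j a by exact: bayes_ge0.
have BM j : 0 < b t j ord_max by exact: bayes_gt0.
have NM : 0 < \prod_(j < n) b t j ord_max `^ W i j.
  by apply: prodr_gt0 => j _; exact: powR_gt0.
have D0 : 0 < \sum_(a < m.+1) \prod_(j < n) b t j a `^ W i j.
  rewrite (bigD1 ord_max)//= ltr_pwDl// sumr_ge0// => a _.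
  by apply: prodr_ge0 => j _; exact: powR_ge0.
rewrite -/q !beliefS.
have -> : \sum_(a < m.+1) fine (expeR (consensus_exponent W (b t) i a)) =
    \sum_(a < m.+1) \prod_(j < n) b t j a `^ W i j.
  by apply: eq_bigr => a _; rewrite consensus_weight.
rewrite !consensus_weight// invf_div mulrA divfK ?gt_eqF//.
have -> : \prod_(j < n) b t j k `^ W i j =
   \prod_(j < n) (b t j k / b t j ord_max) `^ W i j * \prod_(j < n) b t j ord_max `^ W i j.
  rewrite -big_split/=; apply: eq_bigr => j _.
  rewrite -powRM; [by rewrite divfK// gt_eqF| |exact: ltW].
  by rewrite divr_ge0// ltW.
rewrite mulfK ?gt_eqF//; apply: eq_bigr => j _; congr (_ `^ _).
rewrite !bE mulf_div; have := bayes_den t j (Q0 j) (QM j).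
by move: (\sum_(a < _) _) => d d0; rewrite invf_div mulrA divfK ?gt_eqF.
Qed.

End Beliefs.

(** * Growth of the belief ratios *)

Section Ratios.
Context {R : realType} {n : nat} (W : 'M[R]_n) (v : 'I_n -> R).
Hypotheses (W0 : forall i j, 0 <= W i j) (W1 : forall i, \sum_j W i j = 1).
Hypotheses (sc : strongly_connected W) (v0 : forall i, 0 <= v i).
Hypotheses (v1 : \sum_i v i = 1) (vW : forall i, v i = \sum_(j < n) v j * W j i).

Lemma stationary_vector_gt0 i : 0 < v i.
Proof.
case: n W v W0 W1 sc v0 v1 vW i => [|n'] W' v' W0' W1' sc' v0' v1' vW' i.
  by case: i.
have := @stationary_gt0 _ _ W' (\row_j v' j).
move=> /(_ _ _ _ _ _ i); rewrite mxE; apply => //.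
- by apply/rowP => j; rewrite !mxE vW'; apply: eq_bigr => k _; rewrite mxE.
- by move=> j; rewrite mxE.
- by under eq_bigr do rewrite mxE.
Qed.

(** [z] solves the linear recursion driven by [u]. Since powers are monotone, an upper bound on
    [rho] passes to [r]. The clause with equality serves finite divergences, the bound serves the
    clipped ratios. *)
Lemma ratio_growth (r rho u : nat -> 'I_n -> R) (e : 'I_n -> R) :
  (forall i, 0 < r 0 i) -> (forall t j, 0 <= rho t j <= expR (u t j)) ->
  (forall t i, r t.+1 i = \prod_j (rho t j * r t j) `^ W i j) ->
  (forall N s j, (0 < N)%N ->
    (fun t => (\sum_(l < t) u (s + l * N)%N j) / t%:R) @ \oo --> e j) ->
  exists z : nat -> 'I_n -> R,
   [/\ forall t i, 0 <= r t i <= expR (z t i),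
      (forall t j, rho t j = expR (u t j)) -> forall t i, r t i = expR (z t i) &
      forall i, (fun t => z t i / t%:R) @ \oo --> \sum_j v j * e j].
Proof.
move=> r0 rhou rS ue.
pose z := nat_rect (fun=> 'I_n -> R) (fun i => ln (r 0%N i))
  (fun t zt i => \sum_j W i j * (u t j + zt j)).
have expz t i : expR (z t.+1 i) = \prod_j (expR (u t j) * expR (z t j)) `^ W i j.
  rewrite /= expR_sum; apply: eq_bigr => j _.
  by rewrite -expRD /powR gt_eqF ?expR_gt0// expRK.
have rge0 t : forall i, 0 <= r t i.
  elim: t => [|t IH] i; first exact: ltW.
  by rewrite rS; apply: prodr_ge0 => j _; exact: powR_ge0.
exists z; split.
- elim=> [|t IH] i; first by rewrite /= lnK ?posrE// lexx ltW.
  rewrite rge0/= rS expz ler_prod// => j _; rewrite powR_ge0/=.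
  have /andP[rho0 rho1] := rhou t j; have /andP[_ rz] := IH j.
  rewrite ge0_ler_powR ?nnegrE ?mulr_ge0 ?expR_ge0//.
  by rewrite ler_pM.
- move=> E; elim=> [|t IH] i; first by rewrite /= lnK ?posrE.
  by rewrite rS expz; apply: eq_bigr => j _; rewrite E IH.
- have zS t i : z t.+1 i = \sum_j W i j * (u t j + z t j) by [].
  move: (z) zS => {expz}zz zS.
  (* The matrix ring requires a positive size; for size 0 there is no [i]. *)
  case: n W v u e zz W0 W1 sc v0 v1 vW ue zS {r rho r0 rhou rS rge0 z}.
    by move=> ? ? ? ? ? ? ? ? ? ? ? ? ? [].
  move=> n' W' v' u e z W0' W1' sc' v0' v1' vW' ue zS i.
  have := @consensus_average _ _ W' (\row_j v' j) _ _ _ _ _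
    (fun t => \col_j u t j) (fun t => \col_j z t j) (\col_j e j).
  move=> /(_ _ _ _ _ _ _ _ i).
  have -> : (fun t => (\col_j z t j) i 0 / t%:R) = (fun t => z t i / t%:R).
    by apply/funext => t; rewrite mxE.
  have -> : \sum_j (\row_j v' j) 0 j * (\col_j e j) j 0 = \sum_j v' j * e j.
    by apply: eq_bigr => j _; rewrite !mxE.
  apply => //.
  + by apply/rowP => j; rewrite !mxE vW'; apply: eq_bigr => k _; rewrite mxE.
  + by move=> j; rewrite mxE.
  + by under eq_bigr do rewrite mxE.
  + move=> N s j N0; rewrite mxE.
    have := ue N s j N0; apply: cvg_trans; apply: near_eq_cvg; apply: nearW => t.
    by congr (_ / _); apply: eq_bigr => l _; rewrite mxE.
  + move=> t; apply/colP => j; rewrite !mxE zS.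
    by apply: eq_bigr => k _; rewrite !mxE.
Qed.

End Ratios.

(** * From linear growth to limits and rates *)

Section Limits.
Context {R : realType}.

Lemma expR_linear_cvg0 (z : nat -> R) (l : R) : l < 0 ->
  (fun t => z t / t%:R) @ \oo --> l -> (fun t => expR (z t)) @ \oo --> 0.
Proof.
move=> l0 zl.
have c1 : `|expR (l / 2)| < 1.
  by rewrite ger0_norm ?expR_ge0// expR_lt1; lra.
apply: (squeeze_cvgr _ (cvg_cst 0) (cvg_expr c1)).
near=> t; rewrite expR_ge0/= -expRM_natl ler_expR.
have t0 : 0 < t%:R :> R by rewrite ltr0n; near: t; exact: nbhs_infty_gt.
have : z t / t%:R <= l / 2.
  have : `|l - z t / t%:R| <= - l / 2.
    near: t; move/cvgrPdist_le: zl; apply; lra.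
  by rewrite ler_norml; move: (z t / t%:R) => a; lra.
by rewrite ler_pdivrMr// mulrC.
Unshelve. all: by end_near. Qed.

(** A belief equal to 0 has rate [+oo], so the bound covers it too. *)
Lemma neg_log_rate_ge (q z : R) (t : nat) : (0 < t)%N -> 0 <= q -> q <= expR z ->
  ((- (z / t%:R))%:E <= - ((t%:R)^-1)%:E * lne q%:E)%E.
Proof.
move=> t0 q0 qz; have V0 : 0 < (t%:R)^-1 :> R by rewrite invr_gt0 ltr0n.
have [->|qn0] := eqVneq q 0.
  rewrite le0_lneNy// -EFinN lt0_muleNy ?leey// lte_fin; lra.
have qp : 0 < q by rewrite lt0r qn0.
rewrite lne_EFin// -EFinN -EFinM lee_fin mulNr lerN2 mulrC ler_pM2r//.
by rewrite -ler_expR lnK// posrE.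
Qed.

(** [log q] is [z + log qM], and the last term vanishes as [qM] tends to 1. *)
Lemma neg_log_rate_cvg (q qM z : nat -> R) (l : R) :
  (fun t => z t / t%:R) @ \oo --> l -> qM @ \oo --> (1 : R) ->
  (forall t, 0 < qM t) -> (forall t, q t / qM t = expR (z t)) ->
  (fun t => (- ((t%:R)^-1)%:E * lne (q t)%:E)%E) @ \oo --> (- l)%:E.
Proof.
move=> zl qM1 qM0 qE.
have qq t : q t = expR (z t) * qM t by rewrite -qE divfK// gt_eqF.
have lq : (fun t => ln (qM t)) @ \oo --> (0 : R).
  by rewrite -ln1; apply: continuous_cvg => //; apply: continuous_ln.
have Vt : (fun t : nat => (t%:R : R)^-1) @ \oo --> (0 : R).
  apply/gtr0_cvgV0; last exact: cvgr_idn.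
  by exists 1%N => // t; rewrite /= ltr0n.
have H := cvgN (cvgD zl (cvgM Vt lq)).
rewrite mul0r addr0 in H.
have -> : (fun t => (- ((t%:R)^-1)%:E * lne (q t)%:E)%E) =
    EFin \o (fun t => - (z t / t%:R + (t%:R)^-1 * ln (qM t))).
  apply/funext => t; have q0 : 0 < q t by rewrite qq mulr_gt0// expR_gt0.
  rewrite lne_EFin// -EFinN -EFinM qq lnM ?posrE ?expR_gt0// expRK.
  by congr EFin => /=; ring.
by apply: cvg_EFin; [exact: nearW|exact: H].
Qed.

End Limits.

(** * Log-likelihood ratios and the Kullback-Leibler divergence *)

Section Density.
Context {R : realType} {d d1} {Omega : measurableType d} {T : measurableType d1}.
Variables (P : probability Omega R) (mu : {measure set T -> \bar R}).
Variables (X : Omega -> T) (p : T -> R).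
Hypotheses (mX : measurable_fun setT X) (mp : measurable_fun setT p).
Hypotheses (p0 : forall x, 0 <= p x).
Hypothesis (Xp : forall A, measurable A ->
  (P (X @^-1` A) = \int[mu]_(x in A) (p x)%:E)%E).

Import HBNNSimple.

Lemma density_nnsfun (h : {nnsfun T >-> R}) :
  (\int[P]_w (h (X w))%:E = \int[mu]_x (p x * h x)%:E)%E.
Proof.
have mh k : measurable (h @^-1` [set k]) by exact: measurable_sfunP.
have mI k : measurable_fun setT (\1_(h @^-1` [set k]) : T -> R).
  exact: measurable_indic.
transitivity (\sum_(k \in range h) k%:E * P (X @^-1` (h @^-1` [set k])))%E.
  under eq_integral do rewrite fimfunE -fsumEFin//.
  rewrite ge0_integral_fsum//; last 2 first.
  - move=> k; apply/measurable_EFinP; apply: measurable_funM => //.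
    exact: measurableT_comp.
  - by move=> k w _; rewrite EFinM nnfun_muleindic_ge0.
  apply: eq_fsbigr => k; rewrite inE => -[x _ <-].
  under eq_integral do rewrite EFinM.
  rewrite ge0_integralZl_EFin//; last by apply/measurable_EFinP; exact: measurableT_comp.
  congr (_ * _)%E; rewrite -[LHS]/(\int[P]_w (\1_(X @^-1` (h @^-1` [set h x])) w)%:E)%E.
  by rewrite integral_indic ?setIT// -[X in measurable X]setTI; exact: mX.
under [RHS]eq_integral => x _.
  rewrite fimfunE fsbig_finite//= mulr_sumr -sumEFin -fsbig_finite//=; over.
rewrite ge0_integral_fsum//; last 2 first.
- move=> k; apply/measurable_EFinP; apply: measurable_funM => //.
  exact: measurable_funM.
- move=> k x _; rewrite lee_fin mulr_ge0//.
  by have := nnfun_muleindic_ge0 h k x; rewrite -EFinM lee_fin.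
apply: eq_fsbigr => k; rewrite inE => -[x _ <-].
rewrite Xp// integral_mkcond -ge0_integralZl_EFin//; last 2 first.
- by move=> y _; rewrite erestrict_ge0// => z _; rewrite lee_fin.
- by apply/(measurable_restrictT _ (mh _)).1/measurable_EFinP/measurable_funTS.
apply: eq_integral => y _; rewrite patchE/= indicE.
by case: ifPn => _; rewrite ?mule0 ?mulr0 ?mulr1// -EFinM mulrC.
Qed.

Lemma ge0_integral_density (g : T -> \bar R) : measurable_fun setT g ->
  (forall x, 0 <= g x)%E ->
  (\int[P]_w g (X w) = \int[mu]_x ((p x)%:E * g x))%E.
Proof.
move=> mg g0.
pose g_ := nnsfun_approx measurableT mg.
have gcvg x : (g_ n x)%:E @[n --> \oo] --> g x.
  by apply: cvg_nnsfun_approx.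
transitivity (limn (fun n => \int[P]_w (g_ n (X w))%:E))%E.
  rewrite -monotone_convergence//.
  - by apply: eq_integral => w _; apply/esym/cvg_lim => //; exact: gcvg.
  - by move=> n; apply/measurable_EFinP; exact: measurableT_comp.
  - by move=> n w _; rewrite lee_fin.
  - by move=> w _ a b ab; rewrite lee_fin; exact/lefP/nd_nnsfun_approx.
under eq_fun do rewrite density_nnsfun.
rewrite -monotone_convergence//.
- apply: eq_integral => x _; apply/cvg_lim => //.
  under eq_fun do rewrite EFinM.
  by apply: cvgeZl.
- by move=> n; apply/measurable_EFinP; exact: measurable_funM.
- by move=> n x _; rewrite lee_fin mulr_ge0.
- move=> x _ a b ab; rewrite lee_fin ler_wpM2l//; exact/lefP/nd_nnsfun_approx.
Qed.

Lemma density_ae_gt0 : {ae P, forall w, 0 < p (X w)}.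
Proof.
have mN : measurable (p @^-1` [set 0]).
  by rewrite -[X in measurable X]setTI; exact: mp.
exists (X @^-1` (p @^-1` [set 0])); split.
- by rewrite -[X in measurable X]setTI; exact: mX.
- by rewrite Xp// integral0_eq// => x ->.
- by move=> w /= /negP; rewrite -leNgt => pw; apply/eqP; rewrite eq_le pw p0.
Qed.

Variable (r : T -> R).
Hypotheses (mr : measurable_fun setT r) (r0 : forall x, 0 <= r x).
Hypotheses (p1 : (\int[mu]_x (p x)%:E = 1)%E) (r1 : (\int[mu]_x (r x)%:E = 1)%E).

(* Positive parts of [ln rho] and [- ln rho].  Since [ln] is 0 on nonpositive
   reals, [hp] encodes separately the value [+oo] taken where [rho] vanishes. *)
Let rho x := r x / p x.
Let hm x := Num.max (ln (rho x)) 0.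
Let hp x : \bar R := if rho x <= 0 then +oo%E else (Num.max (- ln (rho x)) 0)%:E.

Let rho0 x : 0 <= rho x. Proof. by rewrite divr_ge0. Qed.

Let mrho : measurable_fun setT rho.
Proof.
apply: measurable_funM => //.
have -> : (fun x => (p x)^-1) = (fun x => p x `^ (-1)).
  by apply/funext => x; rewrite powR_inv1.
by apply: (measurableT_comp (measurable_powR _)).
Qed.

Lemma measurable_log_ratio : measurable_fun setT (fun x => ln (r x / p x)).
Proof. by apply: (measurableT_comp (@measurable_ln R)). Qed.

Let mhm : measurable_fun setT hm.
Proof. by apply: measurable_maxr => //; exact: measurable_log_ratio. Qed.

Let mhp : measurable_fun setT hp.
Proof.
apply: measurable_fun_ifT => //; first exact: measurable_fun_ler.
apply/measurable_EFinP; apply: measurable_maxr => //.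
by apply: measurableT_comp => //; exact: measurable_log_ratio.
Qed.

Let hm0 x : 0 <= hm x. Proof. by rewrite le_max lexx orbT. Qed.
Let hp0 x : (0 <= hp x)%E.
Proof. by rewrite /hp; case: ifP; rewrite ?leey// lee_fin le_max lexx orbT. Qed.

(** Where [p] vanishes, [rho] is 0 by the convention on division and [hp] is [+oo], but the factor
    [p] makes the product 0, as in [kl_integrand]. *)
Let klE x : kl_integrand (p x) (r x) = ((p x)%:E * (hp x - (hm x)%:E))%E.
Proof.
rewrite /kl_integrand /hp /hm /rho; have [->|pn0] := eqVneq (p x) 0.
  by rewrite mul0e.
have pp : 0 < p x by rewrite lt0r pn0 p0.
have [->|rn0] := eqVneq (r x) 0.
  by rewrite mul0r lexx ln0// maxxx sube0 gt0_muley// lte_fin.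
have rp : 0 < r x by rewrite lt0r rn0 r0.
rewrite leNgt divr_gt0//= -EFinB -EFinM; congr EFin; congr (_ * _).
have -> : ln (p x / r x) = - ln (r x / p x) by rewrite -lnV ?posrE ?divr_gt0// invf_div.
by case: leP => ?; case: leP => ?; lra.
Qed.

Let kl_pos_neg x : (maxe (kl_integrand (p x) (r x)) 0 = (p x)%:E * hp x)%E /\
  (maxe (- kl_integrand (p x) (r x)) 0 = (p x * hm x)%:E)%E.
Proof.
rewrite klE /hp /hm; have [->|pn0] := eqVneq (p x) 0.
  by rewrite !mul0e oppe0 maxxx mul0r.
have pp : (0 < (p x)%:E)%E by rewrite lte_fin lt0r pn0 p0.
case: ifP => rho_le0.
  have -> : Num.max (ln (rho x)) 0 = 0 by rewrite ln0// maxxx.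
  by rewrite sube0 gt0_muley// mulr0; split; [exact: max_l|exact: max_r].
rewrite -EFinB -EFinM -EFinN -!EFin_max.
have -> : Num.max (- ln (rho x)) 0 - Num.max (ln (rho x)) 0 = - ln (rho x).
  by case: leP => ?; case: leP => ?; lra.
by rewrite -EFinM !maxr_pMr// mulr0 mulrN opprK.
Qed.

Let Hm := (\int[P]_w (hm (X w))%:E)%E.
Let Hp := (\int[P]_w (hp (X w)))%E.

Let HmE : Hm = (\int[mu]_x (p x * hm x)%:E)%E.
Proof.
apply: (ge0_integral_density (fun x => (hm x)%:E)); first exact/measurable_EFinP.
by move=> x; rewrite lee_fin.
Qed.

Let HpE : Hp = (\int[mu]_x ((p x)%:E * hp x))%E.
Proof. exact: ge0_integral_density. Qed.

Let KLE : KL mu p r = (Hp - Hm)%E.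
Proof.
rewrite /KL integralE HmE HpE; congr (_ - _)%E.
  by apply: eq_integral => x _; rewrite funeposE (kl_pos_neg x).1.
by apply: eq_integral => x _; rewrite funenegE (kl_pos_neg x).2.
Qed.

(** Because of this bound, [Hp - Hm] is never of the form [+oo - +oo]. *)
Let Hm_le1 : (0 <= Hm <= 1)%E.
Proof.
apply/andP; split; first by apply: integral_ge0 => w _; rewrite lee_fin.
rewrite HmE -r1; apply: ge0_le_integral => //.
- by move=> x _; rewrite lee_fin mulr_ge0.
- by apply/measurable_EFinP; exact: measurable_funM.
- exact/measurable_EFinP.
- move=> x _; rewrite lee_fin /hm /rho.
  have [->|pn0] := eqVneq (p x) 0; first by rewrite mul0r.
  have pp : 0 < p x by rewrite lt0r pn0 p0.
  rewrite mulrC -ler_pdivlMr// ge_max divr_ge0// andbT.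
  have [rx0|rx0] := leP (r x / p x) 0; first by rewrite ln0// divr_ge0.
  exact/ltW/ln_sublinear.
Qed.

Let Hm_fin : Hm \is a fin_num.
Proof.
have /andP[h0 h1] := Hm_le1; rewrite ge0_fin_numE//.
by rewrite (le_lt_trans h1)// ltry.
Qed.

(** Gibbs' inequality from [ln y <= y - 1], arranged as [p * hm + p <= p * hp + r] so that all
    integrands are nonnegative. *)
Lemma KL_ge0 : (0 <= KL mu p r)%E.
Proof.
rewrite KLE sube_ge0 ?Hm_fin//.
rewrite -(@leeD2rE _ 1%E)// -{1}p1 -r1 HmE HpE.
have mph : measurable_fun setT (fun x => (p x * hm x)%:E).
  by apply/measurable_EFinP; exact: measurable_funM.
have mphp : measurable_fun setT (fun x => (p x)%:E * hp x)%E.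
  by apply: emeasurable_funM => //; exact/measurable_EFinP.
have mpE : measurable_fun setT (EFin \o p) by exact/measurable_EFinP.
have mrE : measurable_fun setT (EFin \o r) by exact/measurable_EFinP.
have ph0 x : (0 <= (p x * hm x)%:E)%E by rewrite lee_fin mulr_ge0.
have php0 x : (0 <= (p x)%:E * hp x)%E by rewrite mule_ge0// lee_fin.
rewrite -!ge0_integralD//; do ?[by move=> x _; rewrite lee_fin].
apply: ge0_le_integral => //.
- by move=> x _; rewrite adde_ge0// lee_fin.
- exact: emeasurable_funD.
- exact: emeasurable_funD.
move=> x _; rewrite /hp /hm; have [px0|pn0] := eqVneq (p x) 0.
  by rewrite px0 mul0e mul0r !add0e lee_fin.
have pp : 0 < p x by rewrite lt0r pn0 p0.
case: ifP => rho_le0; first by rewrite gt0_muley ?lte_fin// addye// leey.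
have rp : 0 < rho x by rewrite ltNge rho_le0.
rewrite -EFinM -!EFinD lee_fin.
have rE : r x = rho x * p x by rewrite /rho divfK.
have : ln (rho x) <= rho x - 1.
  by have := @le_ln1Dx R (rho x - 1); rewrite addrCA subrr addr0; apply; lra.
move=> lnrho; rewrite rE (mulrC (rho x)) -{2}[p x]mulr1 -!mulrDr ler_pM2l//.
by case: (leP (ln _) 0) => ?; case: (leP (- ln _) 0) => ?; lra.
Qed.

Let ge0_integrable (g : T -> R) : measurable_fun setT g -> (forall x, 0 <= g x) ->
  (\int[P]_w (g (X w))%:E < +oo)%E -> P.-integrable setT (fun w => (g (X w))%:E).
Proof.
move=> mg g0 gfin; apply/integrableP; split.
  by apply/measurable_EFinP; exact: measurableT_comp.
by under eq_integral => w _ do rewrite gee0_abs ?lee_fin//.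
Qed.

Let ihm : P.-integrable setT (fun w => (hm (X w))%:E).
Proof. by apply: ge0_integrable => //; rewrite -ge0_fin_numE ?Hm_fin//; case/andP: Hm_le1. Qed.

Let Hp0 : (0 <= Hp)%E. Proof. exact: integral_ge0. Qed.

(** A finite divergence makes [hp] almost surely finite, so [rho] is almost surely positive and [hp]
    may be exchanged for the real function [rm]. *)
Lemma log_ratio_integrable : (KL mu p r < +oo)%E ->
  [/\ {ae P, forall w, 0 < r (X w)},
      P.-integrable setT (fun w => (ln (r (X w) / p (X w)))%:E) &
      (\int[P]_w (ln (r (X w) / p (X w)))%:E = - KL mu p r)%E].
Proof.
rewrite KLE => Kfin.
have Hpfin : (Hp < +oo)%E.
  by move: Kfin; rewrite -(fineK Hm_fin); case: (Hp) => //= ? _; rewrite ltry.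
have mhpX : measurable_fun setT (fun w => hp (X w)) by exact: measurableT_comp.
have ihp : P.-integrable setT (fun w => hp (X w)).
  by apply/integrableP; split => //; under eq_integral => w _ do rewrite gee0_abs//.
have aerho : {ae P, forall w, 0 < rho (X w)}.
  have /integrable_ae -/(_ measurableT) := ihp.
  apply: filterS => w /(_ I); rewrite /hp; case: ifP => // /negbT.
  by rewrite -ltNge.
pose rm x := Num.max (- ln (rho x)) 0.
have mrm : measurable_fun setT rm.
  by apply: measurable_maxr => //; apply: measurableT_comp => //; exact: measurable_log_ratio.
have rm0 x : 0 <= rm x by rewrite le_max lexx orbT.
have Erm : (\int[P]_w (rm (X w))%:E = Hp)%E.
  apply: ae_eq_integral => //.
    by apply/measurable_EFinP; exact: measurableT_comp.
  by apply: filterS aerho => w rw _; rewrite /hp leNgt rw.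
have irm : P.-integrable setT (fun w => (rm (X w))%:E).
  by apply: ge0_integrable => //; rewrite Erm.
have uE w : (ln (r (X w) / p (X w)))%:E = ((hm (X w))%:E - (rm (X w))%:E)%E.
  rewrite -EFinB; congr EFin; rewrite /hm /rm /rho.
  by case: (leP _ 0) => ?; case: (leP _ 0) => ?; lra.
split.
- apply: filterS2 aerho density_ae_gt0 => w rw pw.
  by move: rw; rewrite /rho pmulr_lgt0 ?invr_gt0.
- under eq_fun do rewrite uE.
  exact: integrableB.
- under eq_integral => w _ do rewrite uE.
  rewrite integralB// Erm -/Hm; have := Hm_fin; move: (Hm) (Hp) => a b afin.
  by rewrite fin_num_oppeB// addeC.
Qed.

(** For [0 <= B] the floor is at most 1, so clipping leaves the positive part [hm] alone and caps
    the negative part at [B]. *)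
Let cl B x : R := ln (Num.max (rho x) (expR (- B))).
Let hpB B x : R := Num.max (- cl B x) 0.

Let cl_max B x : 0 <= B -> Num.max (cl B x) 0 = hm x.
Proof.
move=> B0; rewrite /cl /hm; have [rB|//] := leP (rho x) (expR (- B)).
rewrite expRK !max_r//; last by lra.
by rewrite ln_le0// (le_trans rB)// -expR0 ler_expR; lra.
Qed.

Let clE B x : 0 <= B -> cl B x = hm x - hpB B x.
Proof.
move=> B0; rewrite -(@cl_max B)// /hpB.
by case: (leP _ 0) => ?; case: (leP _ 0) => ?; lra.
Qed.

Let clip_gt0 B x : 0 < Num.max (rho x) (expR (- B)).
Proof. by rewrite lt_max expR_gt0 orbT. Qed.

Let cl_geN B x : - B <= cl B x.
Proof. by rewrite /cl -[leLHS]expRK ler_ln ?posrE ?expR_gt0// le_max lexx orbT. Qed.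

Let hpB0 B x : 0 <= hpB B x. Proof. by rewrite le_max lexx orbT. Qed.

Let hpB_le B x : 0 <= B -> hpB B x <= B.
Proof. by move=> B0; rewrite ge_max B0 andbT lerNl cl_geN. Qed.

Lemma measurable_clipped_log_ratio B :
  measurable_fun setT (fun x => ln (Num.max (r x / p x) (expR (- B)))).
Proof. by apply: (measurableT_comp (@measurable_ln R)); exact: measurable_maxr. Qed.

Let mhpB B : measurable_fun setT (hpB B).
Proof.
apply: measurable_maxr => //; apply: measurableT_comp => //.
exact: measurable_clipped_log_ratio.
Qed.

Let ihpB B : 0 <= B -> P.-integrable setT (fun w => (hpB B (X w))%:E).
Proof.
move=> B0; apply: ge0_integrable => //.
apply: (@le_lt_trans _ _ (\int[P]_w (cst B%:E w))%E).
  apply: ge0_le_integral => //.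
  - by move=> w _; rewrite lee_fin.
  - by apply/measurable_EFinP; exact: measurableT_comp.
  - by move=> w _; rewrite lee_fin hpB_le.
rewrite integral_cst// [X in (_ * X)%E](_ : _ = 1%E) ?mule1 ?ltry//.
exact: probability_setT.
Qed.

Let clipE B w : 0 <= B ->
  (ln (Num.max (r (X w) / p (X w)) (expR (- B))))%:E =
  ((hm (X w))%:E - (hpB B (X w))%:E)%E.
Proof. by move=> B0; rewrite -EFinB -clE. Qed.

Lemma clipped_log_ratio_integrable B : 0 <= B ->
  P.-integrable setT (fun w => (ln (Num.max (r (X w) / p (X w)) (expR (- B))))%:E).
Proof.
move=> B0; under eq_fun do rewrite clipE//.
exact: integrableB (ihpB _ B0).
Qed.

Let clipped_expectation B : 0 <= B ->
  (\int[P]_w (ln (Num.max (r (X w) / p (X w)) (expR (- B))))%:E <=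
    1 - \int[P]_w (hpB B (X w))%:E)%E.
Proof.
move=> B0; under eq_integral => w _ do rewrite clipE//.
rewrite integralB//; last exact: ihpB.
by apply: leeB => //; case/andP: Hm_le1.
Qed.

Lemma clipped_log_ratio_le1 B : 0 <= B ->
  (\int[P]_w (ln (Num.max (r (X w) / p (X w)) (expR (- B))))%:E <= 1)%E.
Proof.
move=> B0; apply: le_trans (clipped_expectation B B0) _.
rewrite leeBlDr; last by exact: integrable_fin_num (ihpB B B0).
by rewrite leeDl// integral_ge0// => w _; rewrite lee_fin.
Qed.

(** [hpB] increases to [hp] with [B], also where [rho] vanishes, so by monotone convergence its
    expectation tends to [Hp = +oo], while [hm] contributes at most 1. *)
Lemma clipped_log_ratio_diverges : KL mu p r = +oo%E ->
  forall A : R, \forall B \near \oo,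
    (\int[P]_w (ln (Num.max (r (X w) / p (X w)) (expR (- B%:R))))%:E <= A%:E)%E.
Proof.
rewrite KLE => Koo A.
have HpE' : Hp = +oo%E by move: Koo; rewrite -(fineK Hm_fin); case: (Hp).
have : (\int[P]_w (hpB B%:R (X w))%:E)%E @[B --> \oo] --> Hp.
  have hlim w : (hpB B%:R (X w))%:E @[B --> \oo] --> hp (X w).
    rewrite /hp; case: ifPn => [rho_le0|]; last rewrite -ltNge => rho_gt0.
      apply/cvgeyPge => M; near=> B.
      rewrite lee_fin /hpB /cl [Num.max (rho _) _]max_r; last by rewrite (le_trans rho_le0)// expR_ge0.
      rewrite expRK opprK le_max; apply/orP; left.
      by near: B; exact: nbhs_infty_ger.
    apply: cvg_near_cst; near=> B; congr EFin; rewrite /hpB /cl [Num.max (rho _) _]max_l//.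
    rewrite -[leRHS]lnK ?posrE// ler_expR lerNl.
    by near: B; exact: nbhs_infty_ger.
  have -> : Hp = (\int[P]_w limn (fun B : nat => (hpB B%:R (X w))%:E))%E.
    by apply: eq_integral => w _; apply/esym/cvg_lim => //; exact: hlim.
  apply: cvg_monotone_convergence => //.
  - by move=> B; apply/measurable_EFinP; exact: measurableT_comp.
  - by move=> B w _; rewrite lee_fin.
  - move=> w _ a b ab; rewrite lee_fin /hpB ge_max hpB0 andbT le_max lerN2.
    rewrite /cl ler_ln ?posrE// ge_max !le_max lexx/=.
    by rewrite ler_expR lerN2 ler_nat ab orbT.
rewrite HpE' => /cvgeyPge/(_ (1 - A)); apply: filterS => B HB.
apply: le_trans (clipped_expectation B%:R (ler0n _ _)) _.
apply: le_trans (leeB (lexx 1%E) HB) _.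
by rewrite -EFinB lee_fin; lra.
Unshelve. all: by end_near. Qed.

End Density.

(** * Almost sure rejection rates *)

Section Progressions.
Context {R : realType} {d d1} {Omega : measurableType d} {T : measurableType d1}.
Variables (P : probability Omega R) (X : nat -> Omega -> T).
Hypotheses (mX : forall n, measurable_fun setT (X n)).
Hypotheses (Xid : forall m n, same_law P (X m) (X n)).
Hypothesis (Xind : forall m n, m != n -> indep_pair P (X m) (X n)).

(** There are countably many pairs [N], [s], so one null set serves them all. *)
Lemma slln_progressions (g : T -> R) : measurable_fun setT g ->
  P.-integrable setT (fun w => (g (X 0%N w))%:E) ->
  {ae P, forall w, forall N s, (0 < N)%N ->
     (fun n => (\sum_(l < n) g (X (s + l * N)%N w)) / n%:R) @ \oo -->
       fine (\int[P]_w (g (X 0%N w))%:E)%E}.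
Proof.
move=> mg ig.
have mgE : measurable_fun setT (EFin \o g) by exact/measurable_EFinP.
have ig' s : P.-integrable setT (EFin \o (fun w => g (X s w))).
  apply/integrableP; split; first by apply/measurable_EFinP; exact: measurableT_comp.
  case/integrableP: ig => _; congr (_ < _)%E.
  apply: (same_law_ge0_integral P (X 0%N) (X s) (fun y => `|(g y)%:E|%E)) => //.
  by apply: measurableT_comp.
have Eg s : (\int[P]_w (g (X s w))%:E = \int[P]_w (g (X 0%N w))%:E)%E.
  have EP t : (\int[P]_w ((fun w => (g (X t w))%:E)^\+ w) =
      \int[P]_w ((EFin \o g)^\+ (X t w)))%E.
    by apply: eq_integral => w _; rewrite !funeposE.
  have EN t : (\int[P]_w ((fun w => (g (X t w))%:E)^\- w) =
      \int[P]_w ((EFin \o g)^\- (X t w)))%E.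
    by apply: eq_integral => w _; rewrite !funenegE.
  rewrite integralE [RHS]integralE !EP !EN; congr (_ - _)%E.
    apply: (same_law_ge0_integral P) => //.
    exact: measurable_funepos.
  apply: (same_law_ge0_integral P) => //.
  exact: measurable_funeneg.
apply/ae_foralln => N; apply/ae_foralln => s.
have [N0|] := ltnP 0%N N; last by move=> ?; exact: aeW.
have := @slln _ _ _ P (fun l w => g (X (s + l * N)%N w)).
move=> /(_ _ _ _ _)/filterS; apply.
- by move=> w H _; rewrite mul0n addn0 Eg in H.
- by move=> n; exact: measurableT_comp.
- by move=> n; apply: same_law_comp.
- move=> a b ab; apply: indep_pair_comp => //; apply: Xind.
  by rewrite eqn_add2l eqn_pmul2r.
- exact: ig'.
Qed.

End Progressions.

Theorem theorem1
  (R : realType)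
  (* probability space *)
  (dO : measure_display) (Omega : measurableType dO) (P : probability Omega R)
  (* nodes 'I_n, hypotheses theta_1..theta_M indexed by 'I_m.+1 (M = m+1),
     true hypothesis theta_M = ord_max *)
  (n m : nat)
  (* observation spaces X_i with reference measures mu_i *)
  (dT : 'I_n -> measure_display) (T : forall i : 'I_n, measurableType (dT i))
  (mu : forall i : 'I_n, {measure set (T i) -> \bar R})
  (* marginal densities f_i(. ; theta_k) *)
  (f : forall i : 'I_n, 'I_m.+1 -> T i -> R)
  (f_ge0 : forall i k x, 0 <= f i k x)
  (f_meas : forall i k, measurable_fun setT (f i k))
  (f_int1 : forall i k, (\int[mu i]_x (f i k x)%:E = 1)%E)
  (* observations: X t i is X_i^{(t+1)} *)
  (X : nat -> forall i : 'I_n, Omega -> T i)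
  (X_meas : forall t i, measurable_fun setT (X t i))
  (* the profiles X^{(t)} are mutually independent over t *)
  (X_indep : forall (S : seq nat) (E : nat -> set Omega), uniq S ->
     (forall t, t \in S -> profile_events X t (E t)) ->
     P (\big[setI/setT]_(t <- S) E t) = (\prod_(t <- S) P (E t))%E)
  (* the profiles X^{(t)} are identically distributed *)
  (X_ident : forall t (A : forall i : 'I_n, set (T i)),
     (forall i, measurable (A i)) ->
     P (\big[setI/setT]_(i < n) (X t i @^-1` A i)) =
     P (\big[setI/setT]_(i < n) (X 0 i @^-1` A i)))
  (* the i-th marginal of the law of X^{(t)} is f_i(. ; theta_M) *)
  (X_marg : forall t i (A : set (T i)), measurable A ->
     P (X t i @^-1` A) = (\int[mu i]_(x in A) (f i ord_max x)%:E)%E)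
  (* row-stochastic weight matrix *)
  (W : 'M[R]_n)
  (W_ge0 : forall i j, 0 <= W i j)
  (W_row : forall i, \sum_(j < n) W i j = 1)
  (* stationary distribution v of W *)
  (v : 'I_n -> R)
  (v_ge0 : forall i, 0 <= v i)
  (v_sum : \sum_(i < n) v i = 1)
  (v_stat : forall i, v i = \sum_(j < n) v j * W j i)
  (* initial beliefs *)
  (q0 : 'I_n -> 'I_m.+1 -> R)
  (q0_sum : forall i, \sum_(k < m.+1) q0 i k = 1)
  (* Assumption 1 *)
  (A1 : forall k j : 'I_m.+1, k != j ->
     exists i : 'I_n, (0 < KL (mu i) (f i k) (f i j))%E)
  (* Assumption 2 *)
  (A2 : strongly_connected W)
  (* Assumption 3 *)
  (A3 : forall i k, 0 < q0 i k) :
  let q (w : Omega) (t : nat) := belief f W q0 (fun s i => X s i w) t in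
  let K (k : 'I_m.+1) : \bar R :=
    (\sum_(i < n) (v i)%:E * KL (mu i) (f i ord_max) (f i k))%E in
  forall i : 'I_n,
  {ae P, forall w,
     (fun t => q w t i ord_max) @ \oo --> (1 : R) /\
     (forall k : 'I_m.+1, k != ord_max ->
        (fun t => q w t i k) @ \oo --> (0 : R) /\
        (fun t => (- ((t%:R)^-1)%:E * lne (q w t i k)%:E)%E) @ \oo --> K k)}.
Proof.
move=> q K i.
have v_gt0 := stationary_vector_gt0 W v W_ge0 W_row A2 v_ge0 v_sum v_stat.
have X_law j s t : same_law P (X s j) (X t j) by move=> A mA; rewrite !X_marg.
(* Events of a single node belong to the sigma-algebra of its profile, so this is mutual
   independence for the two times [s] and [t]. *)
have X_ind j s t : s != t -> indep_pair P (X s j) (X t j).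
  move=> st A B mA mB.
  have := X_indep [:: s; t] (fun l => if l == s then X s j @^-1` A else X t j @^-1` B).
  rewrite /= inE st => /(_ isT).
  rewrite !big_cons !big_nil eqxx eq_sym (negbTE st) setIT mule1; apply.
  move=> l; rewrite !inE => /orP[|] /eqP ->; rewrite ?eqxx 1?eq_sym ?(negbTE st);
    apply: sub_sigma_algebra; [by exists j, A|by exists j, B].
pose D j k := KL (mu j) (f j ord_max) (f j k).
have D0 j k : (0 <= D j k)%E.
  exact: (KL_ge0 P (mu j) (X 0%N j) (f j ord_max) (X_meas 0%N j) (f_meas j _)
    (f_ge0 j _) (X_marg 0%N j) (f j k) (f_meas j _) (f_ge0 j _) (f_int1 j _) (f_int1 j _)).
pose rho w k t j := f j k (X t j w) / f j ord_max (X t j w).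
pose Kfin k := [forall j, (D j k < +oo)%E].
pose ratio w k t j := q w t j k / q w t j ord_max.
pose exact_rate w k := exists z : nat -> R, (forall t, ratio w k t i = expR (z t)) /\
  (fun t => z t / t%:R) @ \oo --> - fine (K k).
pose upper_rate w k (A : R) := exists (z : nat -> R) (l : R),
  [/\ forall t, ratio w k t i <= expR (z t), l <= A &
     (fun t => z t / t%:R) @ \oo --> l].
have true_gt0 : {ae P, forall w, forall t j, 0 < f j ord_max (X t j w)}.
  apply/ae_foralln => t; apply: filter_forall => j.
  exact: (density_ae_gt0 P (mu j) (X t j) (f j ord_max) (X_meas t j) (f_meas j _)
    (f_ge0 j _) (X_marg t j)).
have growth w k u e : (forall t j, 0 < f j ord_max (X t j w)) ->
    (forall t j, rho w k t j <= expR (u t j)) ->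
    (forall N s j, (0 < N)%N ->
      (fun t => (\sum_(l < t) u (s + l * N)%N j) / t%:R) @ \oo --> e j) ->
    exists z : nat -> 'I_n -> R,
    [/\ forall t i, 0 <= ratio w k t i <= expR (z t i),
      (forall t j, rho w k t j = expR (u t j)) -> forall t i, ratio w k t i = expR (z t i) &
      forall i, (fun t => z t i / t%:R) @ \oo --> \sum_j v j * e j].
  move=> fM rhou ue.
  apply: (@ratio_growth _ _ W v W_ge0 W_row A2 v_ge0 v_sum v_stat _ (rho w k)) ue.
  - by move=> j; rewrite divr_gt0.
  - by move=> t j; rewrite rhou andbT divr_ge0.
  - by move=> t j; apply: belief_ratioS.
have KE k : Kfin k -> K k = (\sum_j v j * fine (D j k))%:E.
  move=> /forallP KF; rewrite -sumEFin; apply: eq_bigr => j _.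
  by rewrite EFinM fineK// ge0_fin_numE.
have fin_case k : Kfin k -> {ae P, forall w, exact_rate w k}.
  move=> /forallP KF.
  have L j t := @log_ratio_integrable _ _ _ _ _ P (mu j) (X t j) (f j ord_max)
    (X_meas t j) (f_meas j _) (f_ge0 j _) (X_marg t j) (f j k) (f_meas j _) (f_ge0 j _)
    (f_int1 j k) (KF j).
  have Lpos : {ae P, forall w, forall t j, 0 < f j k (X t j w)}.
    by apply/ae_foralln => t; apply: filter_forall => j; case: (L j t).
  have Lavg : {ae P, forall w, forall j N s, (0 < N)%N ->
     (fun t => (\sum_(l < t) ln (rho w k (s + l * N)%N j)) / t%:R) @ \oo --> - fine (D j k)}.
    apply: filter_forall => j; have [_ iL EL] := L j 0%N.
    rewrite -fineN -EL.
    apply: (@slln_progressions _ _ _ _ _ P (fun t => X t j) _ _ _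
      (fun y => ln (f j k y / f j ord_max y))) => //.
    - by move=> s t; exact: X_ind.
    - exact: measurable_log_ratio.
  move: true_gt0 Lpos Lavg; apply: filterS3 => w fM fk avg.
  have rho_gt0 t j : 0 < rho w k t j by rewrite divr_gt0.
  have [|N s j N0|z [_ zE zl]] := growth w k (fun t j => ln (rho w k t j)) (fun j => - fine (D j k)) fM.
  - by move=> t j; rewrite lnK ?posrE.
  - exact: avg.
  exists (z^~ i); split=> [t|].
    by apply: zE => {}t j; rewrite lnK ?posrE.
  have -> : - fine (K k) = \sum_j v j * - fine (D j k).
    rewrite KE; last exact/forallP.
    by rewrite /= -sumrN; apply: eq_bigr => j _; rewrite mulrN.
  exact: zl.
have inf_case k : ~~ Kfin k -> {ae P, forall w, forall A : nat, upper_rate w k (- A%:R)}.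
  rewrite negb_forall => /existsP[j0]; rewrite -leNgt leye_eq => /eqP Dj0.
  pose cl (B : nat) j y : R := ln (Num.max (f j k y / f j ord_max y) (expR (- B%:R))).
  pose e B j := fine (\int[P]_w (cl B j (X 0%N j w))%:E)%E.
  have icl B j : P.-integrable setT (fun w => (cl B j (X 0%N j w))%:E).
    exact: (@clipped_log_ratio_integrable _ _ _ _ _ P (mu j) (X 0%N j) (f j ord_max)
      (X_meas 0%N j) (f_meas j _) (f_ge0 j _) (X_marg 0%N j) (f j k) (f_meas j _) (f_ge0 j _)
      (f_int1 j k) B%:R (ler0n _ _)).
  have e_le1 B j : e B j <= 1.
    rewrite -lee_fin fineK; last exact: integrable_fin_num.
    exact: (clipped_log_ratio_le1 P (mu j) (X 0%N j) (f j ord_max)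
      (X_meas 0%N j) (f_meas j _) (f_ge0 j _) (X_marg 0%N j) (f j k) (f_meas j _) (f_ge0 j _)
      (f_int1 j k) B%:R (ler0n _ _)).
  (* The levels [B] are natural numbers, so a single null set serves all of them and [A] may be
     chosen afterwards. *)
  have avg : {ae P, forall w, forall B j N s, (0 < N)%N ->
     (fun t => (\sum_(l < t) cl B j (X (s + l * N)%N j w)) / t%:R) @ \oo --> e B j}.
    apply/ae_foralln => B; apply: filter_forall => j.
    apply: (@slln_progressions _ _ _ _ _ P (fun t => X t j) _ _ _ (cl B j)) => //.
    - by move=> s t; exact: X_ind.
    - exact: measurable_clipped_log_ratio.
  move: true_gt0 avg; apply: filterS2 => w fM avg A.
  (* The level is chosen so that node [j0] contributes at most [- A - 1] to the weighted mean. The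
     other nodes contribute at most 1 together, since each clipped mean is at most 1 and the weights
     [v] sum to 1. *)
  have [B0 _ HB] := @clipped_log_ratio_diverges _ _ _ _ _ P (mu j0) (X 0%N j0) (f j0 ord_max)
      (X_meas 0%N j0) (f_meas j0 _) (f_ge0 j0 _) (X_marg 0%N j0) (f j0 k) (f_meas j0 _)
      (f_ge0 j0 _) (f_int1 j0 k) Dj0 ((- A%:R - 1) / v j0).
  have [|N s j N0|z [zr _ zl]] := growth w k (fun t j => cl B0 j (X t j w)) (e B0) fM.
  - move=> t j; rewrite lnK ?posrE ?le_max ?lexx// lt_max expR_gt0.
    by rewrite orbT.
  - exact: avg.
  exists (z^~ i), (\sum_j v j * e B0 j); split=> //.
    by move=> t; case/andP: (zr t i).
  have e0 : v j0 * e B0 j0 <= - A%:R - 1.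
    rewrite mulrC -ler_pdivlMr// -lee_fin fineK; last exact: integrable_fin_num.
    by apply: HB => /=.
  have rest : \sum_(j | j != j0) v j * e B0 j <= 1.
    rewrite -v_sum [leRHS](bigD1 j0)//= ler_wpDl// ler_sum// => j _.
    by rewrite ler_piMr.
  by rewrite (bigD1 j0)//=; lra.
have Kgt0 k : k != ord_max -> Kfin k -> 0 < fine (K k).
  move=> kM KF; have [j Dj] := A1 ord_max k ltac:(by rewrite eq_sym).
  rewrite KE//= (bigD1 j)//= ltr_pwDl ?mulr_gt0//.
    rewrite -lte_fin fineK// ge0_fin_numE//.
    by move/forallP: KF.
  by rewrite sumr_ge0// => j' _; rewrite mulr_ge0// fine_ge0.
have Koo k : ~~ Kfin k -> K k = +oo%E.
  rewrite negb_forall => /existsP[j]; rewrite -leNgt leye_eq => /eqP Dj.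
  rewrite /K (bigD1 j)//= -/(D j k) Dj gt0_muley ?lte_fin// addye//.
  rewrite gt_eqF// (lt_le_trans ltNy0)// sume_ge0// => j' _.
  by apply: mule_ge0; [rewrite lee_fin|exact: D0].
have rates : {ae P, forall w, forall k, (Kfin k -> exact_rate w k) /\
    (~~ Kfin k -> forall A : nat, upper_rate w k (- A%:R))}.
  apply: filter_forall => k; have [KF|KF] := boolP (Kfin k).
    by apply: filterS (fin_case k KF).
  by apply: filterS (inf_case k KF).
move: true_gt0 rates; apply: filterS2 => w fM rates.
have distr t := belief_distr W W_ge0 f q0 (fun s i => X s i w) f_ge0 A3 q0_sum fM t.
have q_ge0 t k : 0 <= q w t i k by have [H _ _] := distr t; exact: H.
have qM_gt0 t : 0 < q w t i ord_max by have [_ H _] := distr t; exact: H.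
have q_sum t : \sum_k q w t i k = 1 by have [_ _ H] := distr t; exact: H.
have q_le1 t k : q w t i k <= 1.
  by rewrite -(q_sum t) (bigD1 k)//= lerDl sumr_ge0.
have q_ratio t k : q w t i k <= ratio w k t i.
  by rewrite ler_pdivlMr// ler_piMr.
have q_cvg0 k : k != ord_max -> (fun t => q w t i k) @ \oo --> (0 : R).
  move=> kM; have [fin inf] := rates k.
  (* In either case an upper bound of negative slope is enough; for an infinite divergence a slope
     of at most -1 is taken. *)
  suff [z [l [l0 rz zl]]] : exists (z : nat -> R) (l : R),
      [/\ l < 0, forall t, ratio w k t i <= expR (z t) & (fun t => z t / t%:R) @ \oo --> l].
    apply: (squeeze_cvgr _ (cvg_cst 0) (expR_linear_cvg0 _ _ l0 zl)).
    by apply: nearW => t; rewrite q_ge0 (le_trans (q_ratio t k)).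
  have [KF|KF] := boolP (Kfin k).
    have [z [rz zl]] := fin KF; exists z, (- fine (K k)); split=> //.
      by rewrite oppr_lt0 Kgt0.
    by move=> t; rewrite rz.
  have [z [l [rz lA zl]]] := inf KF 1%N; exists z, l; split=> //.
  by rewrite (le_lt_trans lA)// oppr_lt0.
have qM_cvg : (fun t => q w t i ord_max) @ \oo --> (1 : R).
  have -> : (fun t => q w t i ord_max) = (fun t => 1 - \sum_(k | k != ord_max) q w t i k).
    by apply/funext => t; rewrite -(q_sum t) (bigD1 ord_max)//= addrK.
  rewrite -[X in _ --> X]subr0; apply: cvgB; first exact: cvg_cst.
  rewrite -[X in _ --> X](_ : \sum_(k < m.+1 | k != ord_max) (0 : R) = 0); last by rewrite big1.
  by apply: cvg_big => //; exact: add_continuous.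
split=> // k kM; split; first exact: q_cvg0.
have [fin inf] := rates k; have [KF|KF] := boolP (Kfin k).
  have [z [rz zl]] := fin KF.
  have -> : K k = (- - fine (K k))%:E.
    by rewrite opprK KE.
  exact: neg_log_rate_cvg zl qM_cvg qM_gt0 rz.
rewrite Koo//; apply/cvgeyPge => A.
(* One unit covers [A < (Num.trunc A).+1], the other the distance of [z t / t] from its limit
   [l]. *)
have [z [l [rz lA zl]]] := inf KF (Num.trunc A).+2.
near=> t.
have t0 : (0 < t)%N by near: t; exact: nbhs_infty_gt.
apply: le_trans (neg_log_rate_ge _ (z t) _ t0 (q_ge0 t k) _); last first.
  exact: le_trans (q_ratio t k) (rz t).
rewrite lee_fin.
have : `|l - z t / t%:R| <= 1.
  by near: t; move/cvgrPdist_le: zl; apply.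
have : A < (Num.trunc A).+1%:R by exact: Num.Theory.truncnS_gt.
move: lA; rewrite ler_norml -[(Num.trunc A).+2%:R]natr1; move: (z t / _) => y; lra.
Unshelve. all: by end_near. Qed.
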